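(* Let $N,k$ be positive integers, let $\mu$ be a finite Borel measure in $\mathbb{R}^N$ with a compact support $X$ and let $\phi\colon X \to \mathbb{R}^k$ be a Lipschitz map. Write $\phi_L = \phi + L$ for linear maps $L \in \mathrm{Lin}(\mathbb{R}^N,\mathbb{R}^k)$. Then the following hold. (i) If $\dim_H X < k$, then for almost every linear map $L$ there exists a Borel set $X_L \subset X$ of full $\mu$-measure such that $\phi_L$ is injective on $X_L$ with continuous inverse $(\phi_L|_{X_L})^{-1}\colon \phi_L(X_L)\to X_L$. (ii) If $\overline{\dim}_B X < k$, then for almost every linear map $L$ there exists a Borel set $X_L \subset X$ of full $\mu$-measure such that $\phi_L$ is injective on $X_L$ with inverse which is pointwise $\alpha$-Hölder for every $\alpha \in \big(0, 1-\frac{\overline{\dim}_B X}{k}\big)$. (iii) If $\dim_A X < k$, then for almost every linear map $L$ there exists a Borel set $X_L \subset X$ of full $\mu$-measure on which $\phi_L$ is injective with inverse which is pointwise $\alpha$-Hölder for every $\alpha \in (0,1)$.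
   Context: $\mathrm{Lin}(\mathbb{R}^N,\mathbb{R}^k)$ is the space of linear maps $\mathbb{R}^N\to\mathbb{R}^k$; ''almost every linear map'' refers to the Lebesgue measure on $\mathrm{Lin}(\mathbb{R}^N,\mathbb{R}^k)\simeq\mathbb{R}^{Nk}$. A map $\psi\colon A \to \mathbb{R}^N$, where $A\subset\mathbb{R}^k$, is pointwise $\alpha$-Hölder if for every $x \in A$ there exists $c_x > 0$ such that $\|\psi(x)-\psi(y)\| \le c_x\|x-y\|^\alpha$ for every $y \in A$. $\dim_H$ is the Hausdorff dimension. For bounded $X\subset\mathbb{R}^N$ and $\delta>0$ let $N(X,\delta)$ be the minimal number of balls of radius $\delta$ needed to cover $X$; the upper box-counting dimension is $\overline{\dim}_B X = \limsup_{\delta\to0} \frac{\log N(X,\delta)}{-\log\delta}$. A bounded set $X$ is $(M,s)$-homogeneous if $N(X\cap B(x,r),\rho) \le M(r/\rho)^s$ for every $x\in X$ and $0<\rho<r$; the Assouad dimension is $\dim_A X = \inf\{s>0 : X \text{ is } (M,s)\text{-homogeneous for some } M>0\}$. *)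

(* Defs.v *)
From HB Require Import structures.
From mathcomp Require Import all_boot all_order all_algebra.
From mathcomp Require Import all_classical all_reals all_analysis.
Set Implicit Arguments.
Unset Strict Implicit.
Unset Printing Implicit Defensive.
Import Order.TTheory GRing.Theory Num.Theory.
Import numFieldNormedType.Exports.
Local Open Scope classical_set_scope.
Local Open Scope ring_scope.

Section euclidean.
Context {R : realType} {n : nat}.
Implicit Types (x y : 'rV[R]_n) (A : set 'rV[R]_n).

(* The norm that the library puts on ['rV[R]_n] is the maximum norm; it is
   used below only through its topology, which is the usual one. *)
Definition enorm x : R := Num.sqrt (\sum_(i < n) x ord0 i ^+ 2).

Definition eball x (r : R) : set 'rV[R]_n := [set y | enorm (x - y) < r].

(* 0 is added so that the empty set has diameter 0 and not -oo. *)
Definition ediam A : \bar R :=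
  ereal_sup (0%E |` [set (enorm (p.1 - p.2))%:E | p in A `*` A]).

End euclidean.

Section maps.
Context {R : realType} {m n : nat}.
Implicit Types (f : 'rV[R]_m -> 'rV[R]_n) (A : set 'rV[R]_m).

Definition elipschitz_on A f := exists C : R, forall x y, A x -> A y ->
  enorm (f x - f y) <= C * enorm (x - y).

Definition pointwise_holder_on (alpha : R) A f := forall x, A x ->
  exists2 c : R, 0 < c & forall y, A y ->
    enorm (f x - f y) <= c * enorm (x - y) `^ alpha.

End maps.

Section hausdorff_dimension.
Context {R : realType} {n : nat}.
Implicit Types (A : set 'rV[R]_n) (s delta : R).
Local Open Scope ereal_scope.

Definition hausdorff_premeasure s delta A : \bar R :=
  ereal_inf [set \sum_(0 <= i <oo) poweR (ediam (U i)) s | U in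
    [set U : (set 'rV[R]_n)^nat |
      A `<=` \bigcup_i U i /\ forall i, ediam (U i) <= delta%:E]].

Definition hausdorff_measure s A : \bar R :=
  ereal_sup [set hausdorff_premeasure s delta A | delta in
    [set delta | (0 < delta)%R]].

(* Only [s > 0] is used: this does not change the infimum and it avoids the
   convention needed for [0 `^ 0]. *)
Definition hausdorff_dim A : \bar R :=
  ereal_inf [set s%:E | s in
    [set s | (0 < s)%R /\ hausdorff_measure s A = 0]].

End hausdorff_dimension.

Section box_and_assouad_dimensions.
Context {R : realType} {n : nat}.
Implicit Types (A : set 'rV[R]_n) (s delta M : R).

(* The value is +oo if no finite cover exists, which cannot happen for a
   bounded set. *)
Definition covering_number A delta : \bar R :=
  ereal_inf [set (N%:R)%:E | N in
    [set N : nat | exists c : 'I_N -> 'rV[R]_n,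
      A `<=` \bigcup_i eball (c i) delta]].

Definition upper_box_dim A : \bar R :=
  limf_esup (fun delta : R =>
    lne (covering_number A delta) * ((- ln delta)^-1)%:E)%E 0^'+.

Definition homogeneous M s A := forall (x : 'rV[R]_n) (r rho : R),
  A x -> 0 < rho -> rho < r ->
  (covering_number (A `&` eball x r) rho <= (M * (r / rho) `^ s)%:E)%E.

Definition assouad_dim A : \bar R :=
  ereal_inf [set s%:E | s in
    [set s | 0 < s /\ exists2 M, 0 < M & homogeneous M s A]].

End box_and_assouad_dimensions.

Definition borel_rV (R : realType) (n : nat) :=
  g_sigma_algebraType (@open 'rV[R]_n).

(* The smallest closed set of full measure. *)
Definition measure_support {R : realType} {n : nat}
    (mu : {measure set (borel_rV R n) -> \bar R}) : set 'rV[R]_n :=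
  \bigcap_(F in [set F : set 'rV[R]_n | closed F /\ mu (~` F) = 0%E]) F.

Section tuple_measure.
Context d (T : measurableType d) (R : realType).
Local Open Scope ereal_scope.

Section cons.
Context (nu : {sigma_finite_measure set T -> \bar R}) (n : nat)
  (mu : {sigma_finite_measure set (n.-tuple T) -> \bar R}).

Let pcons (p : T * n.-tuple T) : n.+1.-tuple T := [tuple of p.1 :: p.2].

Let measurable_pcons : measurable_fun setT pcons.
Proof. exact: measurable_cons. Qed.

Definition cons_measure : set (n.+1.-tuple T) -> \bar R :=
  pushforward (nu \x mu) pcons.

Let cons_measure_set0 : cons_measure set0 = 0.
Proof. by rewrite /cons_measure /pushforward preimage_set0 measure0. Qed.

Let cons_measure_ge0 A : 0 <= cons_measure A.
Proof. exact: measure_ge0. Qed.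

Let cons_measure_semi_sigma_additive : semi_sigma_additive cons_measure.
Proof.
exact: (@measure_semi_sigma_additive _ _ _
  (measure_function_pushforward__canonical__measure_function_Measure
    (nu \x mu) measurable_pcons)).
Qed.

HB.instance Definition _ := isMeasure.Build _ _ _ cons_measure
  cons_measure_set0 cons_measure_ge0 cons_measure_semi_sigma_additive.

Lemma cons_measureX (A : set T) (B : set (n.-tuple T)) :
  measurable A -> measurable B ->
  cons_measure [set t | A (thead t) /\ B [tuple of behead t]] = nu A * mu B.
Proof.
move=> mA mB; rewrite -product_measure1E// /cons_measure /pushforward.
have beheadK x (t : n.-tuple T) :
  [tuple of behead [tuple of x :: t]] = t by exact: val_inj.
by congr product_measure1; apply/seteqP; split=> -[x t] /=;
  rewrite theadE beheadK.
Qed.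

Let cons_measure_sigma_finite : sigma_finite setT cons_measure.
Proof.
have /sigma_finiteP[F [TF ndF Foo]] := sigma_finiteT nu.
have /sigma_finiteP[G [TG ndG Goo]] := sigma_finiteT mu.
exists (fun i => [set t : n.+1.-tuple T |
    F i (thead t) /\ G i [tuple of behead t]]).
  apply/seteqP; split=> // t _.
  have [i _ Fi] : (\bigcup_i F i) (thead t) by rewrite -TF.
  have [j _ Gj] : (\bigcup_i G i) [tuple of behead t] by rewrite -TG.
  exists (maxn i j) => //; split.
    by move: Fi; exact/subsetPset/ndF/leq_maxl.
  by move: Gj; exact/subsetPset/ndG/leq_maxr.
move=> i; have [mF Fi] := Foo i; have [mG Gi] := Goo i; split.
  apply: measurableI.
    by rewrite -[X in measurable X]setTI; exact: measurable_tnth.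
  by rewrite -[X in measurable X]setTI; exact: measurable_behead.
by rewrite cons_measureX// lte_mul_pinfty// ge0_fin_numE.
Qed.

HB.instance Definition _ := Measure_isSigmaFinite.Build _ _ _ cons_measure
  cons_measure_sigma_finite.

End cons.

Fixpoint tuple_measure (nu : {sigma_finite_measure set T -> \bar R}) (n : nat) :
    {sigma_finite_measure set (n.-tuple T) -> \bar R} :=
  if n is m.+1 then cons_measure nu (tuple_measure nu m)
  else dirac [tuple].

Lemma tuple_measureX (nu : {sigma_finite_measure set T -> \bar R}) (n : nat)
    (A : 'I_n -> set T) : (forall i, measurable (A i)) ->
  tuple_measure nu n [set t | forall i, A i (tnth t i)] = \prod_(i < n) nu (A i).
Proof.
elim: n A => [|n IH] A mA.
  rewrite big_ord0 /= (_ : [set _ | _] = setT) ?diracT//.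
  by apply/seteqP; split=> // t _ [].
rewrite big_ord_recl -(IH (A \o lift ord0))//=.
rewrite -cons_measureX//; last first.
  rewrite (_ : [set _ | _] = \bigcap_(i in setT) (@tnth n T ^~ i @^-1` A (lift ord0 i))).
    apply: fin_bigcap_measurable => // i _.
    by rewrite -[X in measurable X]setTI; exact: measurable_tnth.
  by apply/seteqP; split=> t /= At i; [move=> _|]; exact: At.
have tnth_beheadE (t : n.+1.-tuple T) i :
    tnth [tuple of behead t] i = tnth t (lift ord0 i).
  rewrite tnth_behead; congr tnth; apply: val_inj.
  by rewrite /= inordK// ltnS ltn_ord.
congr (cons_measure _ _ _); apply/seteqP; split=> t /=.
  by move=> At; split=> [|i]; [exact: At|rewrite tnth_beheadE].
move=> [A0 At] i; case: (unliftP ord0 i) => [j ->|->//].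
by rewrite -tnth_beheadE.
Qed.

End tuple_measure.

Definition lebesgue_tuple (R : realType) (n : nat) :
    {sigma_finite_measure set (n.-tuple (measurableTypeR R)) -> \bar R} :=
  tuple_measure (@lebesgue_measure R) n.

Definition lin_of_coords {R : realType} {N k : nat} (t : (N * k).-tuple R) :
    {linear 'rV[R]_N -> 'rV[R]_k} :=
  mulmxr (vec_mx (\row_i tnth t i)).

Definition ae_lin {R : realType} {N k : nat}
    (P : {linear 'rV[R]_N -> 'rV[R]_k} -> Prop) :=
  {ae lebesgue_tuple R (N * k), forall t, P (lin_of_coords t)}.

(* Main.v *)
(* For fixed [x] and [y] the maps [L] of bounded norm with
   [|phi_L x - phi_L y| <= e] form a set of measure at most
   [C (e / |x - y|)^k].  Replacing [y] by the pieces of a cover of [X], this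
   shows that, for every fixed [x] in [X]:
   - if [X] has covers with arbitrarily small [sum (diam U_i)^k], then for
     almost every [L] no other point of [X] has the same image as [x];
   - if the part of [X] in the ball of radius [2^-n] around [x] is covered by
     [m_n] sets of diameter [rho_n = 2^(-n/alpha)] with [m_n (2^n rho_n)^k]
     geometrically small, then Borel-Cantelli over the dyadic shells around
     [x] gives, for almost every [L], [|x - y| <= c |phi_L x - phi_L y|^alpha]
     on [X].
   By Fubini, for almost every [L] these properties hold at [mu]-almost every
   [x], and [X_L] consists of these [x].  The first condition follows from
   [dim_H X < k], and the second from the box-counting and Assouad bounds. *)
Require Import Defs.
From HB Require Import structures.
From mathcomp Require Import all_boot all_order all_algebra.
From mathcomp Require Import all_classical all_reals all_analysis.
From mathcomp Require Import measurable_realfun ring lra.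
Set Implicit Arguments.
Unset Strict Implicit.
Unset Printing Implicit Defensive.
Import Order.TTheory GRing.Theory Num.Theory.
Import numFieldNormedType.Exports.
Local Open Scope classical_set_scope.
Local Open Scope ring_scope.

(** * Series, dyadic shells and covering conditions *)

Lemma nneseries_finite_support (R : realType) (u : nat -> R) (M : nat) :
  (forall i, 0 <= u i) -> (forall i, (M <= i)%N -> u i = 0) ->
  (\sum_(0 <= i <oo) (u i)%:E = (\sum_(i < M) u i)%:E)%E.
Proof.
move=> u0 uM; rewrite (@nneseries_split _ _ 0 M) ?add0n; last first.
  by move=> i _; rewrite lee_fin.
rewrite [X in (_ + X)%E](_ : _ = 0%E) ?adde0 ?big_mkord ?sumEFin//.
by apply: eseries0 => i Mi _; rewrite uM.
Qed.

Lemma exists_invr_nat_le (R : realType) (e : R) : 0 < e ->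
  exists n : nat, n.+1%:R^-1 <= e.
Proof.
move=> e0; exists (Num.truncn e^-1).
rewrite -[leRHS]invrK lef_pV2 ?posrE ?invr_gt0//.
exact/ltW/truncnS_gt.
Qed.

(** The index is the least [n] with [2 ^- n.+1 <= d]. Its upper bound comes from minimality, or from
    [d < 2 ^- j] with [j = 0] when [n = 0]. *)
Lemma exists_dyadic_shell (R : realType) (d : R) (j : nat) :
  0 < d -> d < 2 ^- j -> exists2 n, (j <= n)%N & 2 ^- n.+1 <= d < 2 ^- n.
Proof.
move=> d0 dj.
have ex : exists n, 2 ^- n.+1 <= d.
  have [n nd] := exists_invr_nat_le d0; exists n; apply: le_trans nd.
  rewrite lef_pV2 ?posrE ?exprn_gt0// -natrX ler_nat.
  exact/ltnW/ltn_expl.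
have /= := @ex_minnP (fun n => 2 ^- n.+1 <= d) ex; case=> n nd min_n.
have jn : (j <= n)%N.
  rewrite leqNgt; apply/negP => nj.
  have := lt_le_trans dj (le_trans _ nd).
  rewrite ltxx lef_pV2 ?posrE ?exprn_gt0// ler_eXn2l ?ltr1n// => /(_ nj) //.
exists n => //; rewrite nd/=; case: n min_n {nd} jn => [|n] min_n jn.
  by move: jn dj; rewrite leqn0 => /eqP ->.
by rewrite ltNge; apply/negP => /min_n; rewrite ltnn.
Qed.

(** For [s > 0] this says that the [s]-dimensional Hausdorff content of [X] vanishes. The numbers
    [delta i] bound the diameters in the maximum norm, so no supremum has to be taken. *)
Definition null_covered (R : realType) (N : nat) (s : nat)
    (X : set 'rV[R]_N) : Prop :=
  forall eta : R, 0 < eta -> exists (U : nat -> set 'rV[R]_N) (delta : nat -> R),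
    [/\ X `<=` \bigcup_i U i, forall i, 0 <= delta i,
      forall i y y', U i y -> U i y' -> `|y - y'| <= delta i &
      (\sum_(0 <= i <oo) (delta i ^+ s)%:E <= eta%:E)%E].

(** The pieces are indexed by all naturals, though only those below [M] have to cover, so that such
    a cover turns directly into a countable one. *)
Definition finite_cover (R : realType) (N : nat) (A : set 'rV[R]_N) (M : nat)
    (rho : R) : Prop :=
  exists U : nat -> set 'rV[R]_N,
    (forall y, A y -> exists2 i, (i < M)%N & U i y) /\
    (forall i y y', U i y -> U i y' -> `|y - y'| <= rho).

(** The base of the power [s] is, up to a factor 2, the ratio of the size of the pieces to the
    distance from [x] to the [n]-th dyadic shell. *)
Definition ball_covered (R : realType) (N : nat) (s : nat) (alpha : R)
    (X : set 'rV[R]_N) (x : 'rV[R]_N) : Prop :=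
  exists C theta n0, [/\ 0 <= C, 0 < theta < 1 &
    forall n, (n0 <= n)%N -> exists M : nat,
      finite_cover [set y | X y /\ `|x - y| < 2 ^- n] M ((2 ^- n) `^ alpha^-1) /\
      M%:R * (2 ^+ n * (2 ^- n) `^ alpha^-1) ^+ s <= C * theta ^+ n].

(** * Lebesgue measure of slabs *)

Section product_measure_bound.
Local Open Scope ereal_scope.
Context d1 d2 (T1 : measurableType d1) (T2 : measurableType d2) (R : realType).
Variables (m1 : {sigma_finite_measure set T1 -> \bar R})
  (m2 : {sigma_finite_measure set T2 -> \bar R}).
Implicit Types (A : set (T1 * T2)) (c : \bar R).

(** Tonelli: sections over points outside [D] are empty, so the integral of their measures lives on
    [D], where it is at most that of the constant [c]. *)
Lemma product_measure1_le_xsection A (D : set T1) c :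
  measurable A -> measurable D -> (forall p, A p -> D p.1) ->
  (forall x, D x -> m2 (xsection A x) <= c) -> (m1 \x m2) A <= c * m1 D.
Proof.
move=> mA mD AD Ac.
have -> : (m1 \x m2) A = \int[m1]_(x in D) m2 (xsection A x).
  rewrite [RHS]integral_mkcond; apply: eq_integral => x _.
  rewrite patchE; case: ifPn => // xD /=.
  rewrite (_ : xsection A x = set0) ?measure0//.
  apply/seteqP; split=> // y /=; rewrite /xsection /= inE => /AD /=.
  by rewrite notin_setE in xD.
rewrite -integral_cst//; apply: ge0_le_integral => //.
by apply: (measurable_funS measurableT) => //; exact: measurable_fun_xsection.
Qed.

Lemma product_measure1_le_ysection A (D : set T2) c :
  measurable A -> measurable D -> (forall p, A p -> D p.2) ->
  (forall y, D y -> m1 (ysection A y) <= c) -> (m1 \x m2) A <= c * m2 D.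
Proof.
move=> mA mD AD Ac.
have -> : (m1 \x m2) A = \int[m2]_(y in D) m1 (ysection A y).
  (* Uniqueness of the product measure allows integrating in the other order. *)
  rewrite (@product_measure_unique _ _ _ _ _ m1 m2 (m1 \x^ m2))//; last first.
    by move=> B C mB mC; exact: product_measure2E.
  rewrite [RHS]integral_mkcond; apply: eq_integral => y _.
  rewrite patchE; case: ifPn => // yD /=.
  rewrite (_ : ysection A y = set0) ?measure0//.
  apply/seteqP; split=> // x /=; rewrite /ysection /= inE => /AD /=.
  by rewrite notin_setE in yD.
rewrite -integral_cst//; apply: ge0_le_integral => //.
by apply: (measurable_funS measurableT) => //; exact: measurable_fun_ysection.
Qed.

End product_measure_bound.

Lemma lebesgue_measure_affine (R : realType) (a b e : R) :
  a != 0 -> 0 <= e ->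
  lebesgue_measure [set x : measurableTypeR R | `|a * x + b| <= e] =
  (2 * e / `|a|)%:E.
Proof.
move=> a0 e0; have na0 : 0 < `|a| by rewrite normr_gt0.
rewrite (_ : [set _ | _] = `[(- b / a - e / `|a|), (- b / a + e / `|a|)]%classic).
  rewrite lebesgue_measure_itv/= lte_fin.
  case: ifPn => [_|]; first by rewrite -EFinB; congr EFin; field; rewrite a0 gt_eqF.
  (* The endpoints fail to be strictly ordered only if [e = 0], and then both sides vanish. *)
  rewrite -leNgt => h; congr EFin.
  have : e / `|a| <= 0 by lra.
  rewrite pmulr_lle0 ?invr_gt0// => e1.
  have -> : e = 0 by apply: le_anti; rewrite e1 e0.
  by rewrite mulr0 mul0r.
apply/seteqP; split=> x /=; rewrite in_itv/= -ler_distl.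
  move=> h; rewrite ler_pdivlMr// -normrM.
  by rewrite (_ : (x - _) * a = a * x + b)//; field.
rewrite ler_pdivlMr// -normrM.
by rewrite (_ : (x - _) * a = a * x + b)//; field.
Qed.
Section slab.
Context {R : realType}.

Definition slab n (W : 'M[R]_n) (v e : 'I_n -> R) :
    set (n.-tuple (measurableTypeR R)) :=
  [set t | forall a, `|\sum_b W a b * tnth t b + v a| <= e a].

Lemma measurable_slab n (W : 'M[R]_n) (v e : 'I_n -> R) :
  measurable (slab W v e).
Proof.
rewrite (_ : slab _ _ _ = \bigcap_(a in setT)
  [set t | `|\sum_b W a b * tnth t b + v a| <= e a]); last first.
  by apply/seteqP; split=> [t h a _|t h a]; exact: h.
apply: fin_bigcap_measurable => // a _.
rewrite -[X in measurable X]setTI.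
apply: measurable_fun_le => //.
apply: measurableT_comp => //; apply: measurable_funD => //.
apply: measurable_sum => b; apply: measurable_funM => //.
exact: measurable_tnth.
Qed.

(* The shape of [W] is inherited by its minors: either the constraint of the
   first coordinate involves no other coordinate, or no other constraint
   involves the first coordinate, and in both cases Fubini separates it. *)
Lemma slab_measure_le n (W : 'M[R]_n) (v e : 'I_n -> R) :
  (forall c, (forall b, b != c -> W c b = 0) \/
             (forall a, a != c -> W a c = 0)) ->
  (forall c, W c c != 0) -> (forall c, 0 <= e c) ->
  (lebesgue_tuple R n (slab W v e) <= (\prod_a (2 * e a / `|W a a|))%:E)%E.
Proof.
elim: n W v e => [|n IH] W v e triW W0 e0.
  rewrite big_ord0; apply: (@le_trans _ _ (dirac ([tuple] : 0.-tuple R) setT)).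
    by apply: le_measure; rewrite ?inE//; exact: measurable_slab.
  by rewrite diracT.
pose W' : 'M[R]_n := \matrix_(a, b) W (lift ord0 a) (lift ord0 b).
pose e' a := e (lift ord0 a).
have triW' c : (forall b, b != c -> W' c b = 0) \/
               (forall a, a != c -> W' a c = 0).
  have [h|h] := triW (lift ord0 c); [left => b bc|right => a ac];
    by rewrite mxE h// (inj_eq lift_inj).
(* The shift stays arbitrary because fixing the first coordinate translates the remaining
   constraints. *)
have IH' v' : (lebesgue_tuple R n (slab W' v' e') <=
    (\prod_a (2 * e' a / `|W' a a|))%:E)%E.
  by apply: IH => // c; rewrite /e' ?mxE.
pose nu : {sigma_finite_measure set (measurableTypeR R) -> \bar R} :=
  @lebesgue_measure R.
pose S := [set p : measurableTypeR R * n.-tuple (measurableTypeR R) |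
  slab W v e [tuple of p.1 :: p.2]].
have mS : measurable S.
  rewrite -[S]setTI; apply: (measurable_cons measurable_fst measurable_snd) => //.
  exact: measurable_slab.
have SE x t : S (x, t) <-> (`|W ord0 ord0 * x +
     \sum_b W ord0 (lift ord0 b) * tnth t b + v ord0| <= e ord0) /\
   (forall a, `|\sum_b W' a b * tnth t b +
     (W (lift ord0 a) ord0 * x + v (lift ord0 a))| <= e' a).
  have sE a : \sum_b W a b * tnth [tuple of x :: t] b + v a = W a ord0 * x +
      \sum_b W a (lift ord0 b) * tnth t b + v a.
    by rewrite big_ord_recl; congr (_ + _ + _); apply: eq_bigr => i _;
      rewrite tnthS.
  split=> [h|[h0 h1] a]; last first.
    rewrite sE; case: (unliftP ord0 a) => [j ->|->//].
    move: (h1 j); congr (`|_| <= _); rewrite addrA; congr (_ + _).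
    by rewrite addrC; congr (_ + _); apply: eq_bigr => b _; rewrite mxE.
  split; first by rewrite -sE; exact: h.
  move=> a; move: (h (lift ord0 a)); rewrite sE; congr (`|_| <= _).
  rewrite addrA; congr (_ + _).
  by rewrite addrC; congr (_ + _); apply: eq_bigr => b _; rewrite mxE.
rewrite [X in (X <= _)%E](_ : _ = (nu \x lebesgue_tuple R n)%E S)//.
rewrite big_ord_recl EFinM -(@lebesgue_measure_affine _ (W ord0 ord0) (v ord0))//.
have affine_measurable u : measurable
    [set x : measurableTypeR R | `|W ord0 ord0 * x + u| <= e ord0].
  rewrite -[X in measurable X]setTI.
  apply: measurable_fun_le => //.
  by apply: measurableT_comp => //; apply: measurable_funD => //;
    apply: measurable_funM.
have -> : \prod_(i < n) (2 * e (lift ord0 i) / `|W (lift ord0 i) (lift ord0 i)|)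
    = \prod_i (2 * e' i / `|W' i i|) by apply: eq_bigr => i _; rewrite mxE.
have [row0|col0] := triW ord0.
  rewrite muleC; apply: product_measure1_le_xsection => //.
    move=> [x t] /SE[+ _] /=; rewrite big1 ?addr0// => b _.
    by rewrite row0 ?mul0r.
  move=> x _.
  apply: le_trans (IH' (fun a => W (lift ord0 a) ord0 * x + v (lift ord0 a))).
  apply: le_measure; rewrite ?inE; [exact: measurable_xsection| |].
    exact: measurable_slab.
  by move=> t; rewrite /xsection /= inE => /SE[].
(* Here the tail [t] ranges over a slab that does not depend on [x], and the interval allowed for
   [x] has a length that does not depend on [t]. *)
rewrite lebesgue_measure_affine//.
apply: (@le_trans _ _ ((2 * e ord0 / `|W ord0 ord0|)%:E *
    lebesgue_tuple R n (slab W' (fun a => v (lift ord0 a)) e'))%E); last first.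
  by rewrite lee_wpmul2l// lee_fin divr_ge0// mulr_ge0.
apply: product_measure1_le_ysection => //; first exact: measurable_slab.
  move=> [x t] /SE[_ h] a /=; apply: le_trans (h a).
  by rewrite col0 ?mul0r ?add0r.
move=> t _.
pose u := \sum_b W ord0 (lift ord0 b) * tnth t b + v ord0.
rewrite -(@lebesgue_measure_affine _ _ u)//.
apply: le_measure; rewrite ?inE; [exact: measurable_ysection| |].
  exact: affine_measurable.
by move=> x; rewrite /ysection /= inE => /SE[+ _]; rewrite addrA.
Qed.

End slab.

Lemma big_mxvec_index (T : Type) (idx : T) (op : Monoid.com_law idx) m n
    (F : 'I_(m * n) -> T) :
  \big[op/idx]_a F a = \big[op/idx]_i \big[op/idx]_j F (mxvec_index i j).
Proof.
rewrite pair_bigA (reindex (uncurry (@mxvec_index m n))) /=.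
  by apply: eq_bigr => -[].
by have [g gK Kg] := @curry_mxvec_bij m n; exists g => i _; [exact: gK|exact: Kg].
Qed.

Section linear_slab.
Context {R : realType} {N k : nat}.
Local Notation T := ((N * k).-tuple (measurableTypeR R)).
Implicit Types (z : 'rV[R]_N) (v : 'rV[R]_k).

(** The boxes with [b] natural exhaust the space of linear maps, so negligibility may be checked in
    each of them. *)
Definition coord_box (b : R) : set T := [set t | forall i, `|tnth t i| <= b].

Lemma lin_of_coordsE (t : T) z j :
  lin_of_coords t z ord0 j = \sum_i z ord0 i * tnth t (mxvec_index i j).
Proof.
by rewrite /lin_of_coords /= /mulmxr mxE; apply: eq_bigr => i _; rewrite !mxE.
Qed.

Lemma row_coord_le n (x : 'rV[R]_n) i : `|x ord0 i| <= `|x|.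
Proof.
rewrite {2}/Num.norm /= mx_normrE.
by apply/bigmax_geP; right; exists (ord0, i).
Qed.

Lemma row_norm_le n (x : 'rV[R]_n) (a : R) :
  0 <= a -> (forall i, `|x ord0 i| <= a) -> `|x| <= a.
Proof.
move=> a0 xa; rewrite /Num.norm /= mx_normrE.
by apply/bigmax_leP; split=> // -[i j] _ /=; rewrite (ord1 i).
Qed.

Lemma row_norm_lt n (x : 'rV[R]_n) (a : R) :
  0 < a -> (`|x| < a) <-> (forall i, `|x ord0 i| < a).
Proof.
move=> a0; split=> [xa i|xa]; first exact: le_lt_trans (row_coord_le _ _) xa.
rewrite /Num.norm /= mx_normrE.
by apply/bigmax_ltP; split=> // -[i j] _ /=; rewrite (ord1 i).
Qed.

(* The coordinates of the row of the matrix on which [z] has its largest entry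
   are confined by the condition on [z]; all the others by the box. *)
Lemma lin_slab_measure_le z v (b r e : R) :
  0 < r -> r <= `|z| -> 0 <= b -> 0 <= e ->
  exists S : set T, [/\ measurable S,
    coord_box b `&` [set t | `|lin_of_coords t z + v| <= e] `<=` S &
    (lebesgue_tuple R (N * k) S <=
      ((2 * b) ^+ (k * N.-1) * (2 * e / r) ^+ k)%:E)%E].
Proof.
move=> r0 rz b0 e0.
have z0 : mx_norm z != 0 by rewrite gt_eqF// (lt_le_trans r0).
have [[u i0] zi0] := mx_norm_neq0 z0; rewrite (ord1 u) /= in zi0.
have {}zi0 : `|z| = `|z ord0 i0| by [].
have zi0_gt0 : 0 < `|z ord0 i0| by rewrite -zi0 (lt_le_trans r0).
have [p pK' Kp'] := @curry_mxvec_bij N k.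
have pK x : p (uncurry (@mxvec_index N k) x) = x by exact: pK'.
have Kp a : uncurry (@mxvec_index N k) (p a) = a by exact: Kp'.
have pE i j : p (mxvec_index i j) = (i, j) by exact: (pK (i, j)).
(* In the indices of row [i0] this matrix computes the coordinates of the image of [z]; in all
   others it is the identity. *)
pose W : 'M[R]_(N * k) := \matrix_(a, c)
  if (p a).1 == i0 then (if (p c).2 == (p a).2 then z ord0 (p c).1 else 0)
  else (a == c)%:R.
pose w (a : 'I_(N * k)) := if (p a).1 == i0 then v ord0 (p a).2 else 0.
pose f (a : 'I_(N * k)) := if (p a).1 == i0 then e else b.
exists (slab W w f); split; first exact: measurable_slab.
  move=> t [tb te] a; rewrite /w /f.
  case: ifPn => [/eqP pa1|pa1]; last first.
    rewrite (bigD1 a)//= big1; last first.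
      by move=> c ca; rewrite mxE (negPf pa1) eq_sym (negPf ca) mul0r.
    by rewrite mxE (negPf pa1) eqxx mul1r !addr0; exact: tb.
  apply: le_trans te; apply: le_trans (row_coord_le _ (p a).2).
  rewrite mxE lin_of_coordsE big_mxvec_index.
  under eq_bigr => i _.
    rewrite (bigD1 (p a).2)//= big1 ?addr0; last first.
      by move=> j ja; rewrite mxE pE pa1 eqxx (negPf ja) mul0r.
    rewrite mxE pE pa1 !eqxx/=; over.
  by [].
apply: le_trans (slab_measure_le _ _ _ _) _.
(* A constraint outside row [i0] concerns a single entry. An entry in row [i0] occurs only in its
   own constraint, as distinct coordinates of the image of [z] use distinct columns. *)
- move=> a; have [pa1|pa1] := eqVneq (p a).1 i0; last first.
    by left => c ca; rewrite mxE (negPf pa1) eq_sym (negPf ca).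
  right => c ca; rewrite mxE; case: eqP => [pc1|_]; last by rewrite (negPf ca).
  case: eqP => // pac; move/negP: ca; case; apply/eqP.
  by rewrite -(Kp c) -(Kp a) (surjective_pairing (p c)) pc1 -pac -pa1
    -surjective_pairing.
- move=> a; rewrite mxE; have [->|_] := eqVneq (p a).1 i0.
    by rewrite eqxx -normr_gt0.
  by rewrite eqxx oner_neq0.
- by move=> a; rewrite /f; case: ifP.
(* The [N.-1] free rows contribute [2 * b] per entry; each of the [k] entries of row [i0]
   contributes [2 * e] over the norm of [z], which is at least [r]. *)
rewrite lee_fin big_mxvec_index (bigD1 i0)//= mulrC; apply: ler_pM.
- apply: prodr_ge0 => i _; apply: prodr_ge0 => j _.
  by rewrite divr_ge0// mulr_ge0// /f; case: ifP.
- by apply: prodr_ge0 => j _; rewrite divr_ge0// mulr_ge0// /f; case: ifP.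
- rewrite le_eqVlt; apply/orP; left; apply/eqP.
  under eq_bigr => i ii0.
    under eq_bigr => j _ do
      rewrite /f mxE pE (negPf ii0) /= eqxx normr1 divr1.
    rewrite prodr_const card_ord; over.
  rewrite prodr_const -exprM; congr (_ ^+ (_ * _)).
  have <- : #|predC1 i0| = N.-1 by rewrite cardC1 card_ord.
  by apply: eq_card => i; rewrite !inE.
- under eq_bigr => j _ do rewrite /f mxE pE /= !eqxx.
  rewrite prodr_const card_ord; apply: lerXn2r; rewrite ?nnegrE.
  + by rewrite divr_ge0// mulr_ge0.
  + by rewrite divr_ge0 ?mulr_ge0// ltW.
  + by rewrite ler_pM// ?mulr_ge0// lef_pV2// -zi0.
Qed.

End linear_slab.

(** * Negligible sets and measurability *)

Section negligible_criteria.
Context d (T : measurableType d) (R : realType).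
Variable mu : {measure set T -> \bar R}.
Local Open Scope ereal_scope.

Lemma negligible_le_eps (A : set T) :
  (forall eps : R, (0 < eps)%R ->
    exists S, [/\ measurable S, A `<=` S & mu S <= eps%:E]) ->
  mu.-negligible A.
Proof.
move=> h.
have /choice[S hS] (n : nat) : exists S,
    [/\ measurable S, A `<=` S & mu S <= (n.+1%:R^-1)%:E].
  by apply: h; rewrite invr_gt0.
have mS : measurable (\bigcap_n S n).
  by apply: bigcapT_measurable => n; have [] := hS n.
exists (\bigcap_n S n); split => //; last first.
  by move=> t At n _; have [_ + _] := hS n; exact.
apply/eqP; rewrite eq_le measure_ge0 andbT.
apply/lee_addgt0Pr => e e0; rewrite add0e.
have [n ne] := exists_invr_nat_le e0.
apply: (@le_trans _ _ (mu (S n))).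
  by apply: le_measure; rewrite ?inE//; [have [] := hS n|exact: bigcap_inf].
by have [_ _ /le_trans] := hS n; apply; rewrite lee_fin.
Qed.

(** Borel-Cantelli, phrased with measurable supersets because the sets [E n] are not known to be
    measurable. *)
Lemma negligible_limsup_geometric (E : nat -> set T) (n0 : nat) (C theta : R) :
  (0 <= C)%R -> (0 < theta < 1)%R ->
  (forall n, (n0 <= n)%N -> exists S,
    [/\ measurable S, E n `<=` S & mu S <= (C * theta ^+ n)%:E]) ->
  mu.-negligible (lim_sup_set E).
Proof.
move=> C0 /andP[th0 th1] h.
(* The empty set stands in below [n0], so that the geometric bound holds from index 0. *)
have /choice[S hS] n : exists S, [/\ measurable S,
    (n0 <= n)%N -> E n `<=` S & mu S <= (C * theta ^+ n)%:E].
  have [n0n|nn0] := leqP n0 n; first by have [S [*]] := h n n0n; exists S; split.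
  by exists set0; split => //; rewrite measure0 lee_fin mulr_ge0// exprn_ge0// ltW.
have mS n : measurable (S n) by have [] := hS n.
exists (lim_sup_set S); split.
- by apply: bigcapT_measurable => n; exact: bigcup_measurable.
- apply: lim_sup_set_cvg0 => //.
  apply: (@le_lt_trans _ _ (C * (1 - theta)^-1)%:E); last exact: ltry.
  apply: lime_le; first exact: is_cvg_nneseries.
  apply: nearW => n; apply: (@le_trans _ _ (series (geometric C theta) n)%:E).
    rewrite /series/= -sumEFin; apply: lee_sum => i _.
    by have [] := hS i.
  by rewrite lee_fin geometric_le_lim// ger0_norm// ltW.
move=> t Et n _; have [m /= + Emt] := Et (maxn n0 n) I.
rewrite geq_max => /andP[n0m nm]; exists m => //.
by have [_ + _] := hS m; apply.
Qed.

End negligible_criteria.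

(** Null [x]-sections make [B] null for the product measure; the measures of the [y]-sections then
    have integral zero and vanish almost everywhere. *)
Lemma ae_null_ysections d1 d2 (T1 : measurableType d1) (T2 : measurableType d2)
    (R : realType) (m1 : {sigma_finite_measure set T1 -> \bar R})
    (m2 : {sigma_finite_measure set T2 -> \bar R}) (B : set (T1 * T2)) :
  measurable B -> (forall x, m2.-negligible (xsection B x)) ->
  {ae m2, forall y, m1 (ysection B y) = 0%E}.
Proof.
move=> mB B0.
have B00 : (m1 \x m2)%E B = 0%E.
  apply/eqP; rewrite -measure_le0 -(mul0e (m1 setT)).
  apply: product_measure1_le_xsection => // x _.
  by rewrite measure_negligible//; exact: measurable_xsection.
have : (\int[m2]_y `|m1 (ysection B y)| = 0)%E.
  rewrite -B00 (@product_measure_unique _ _ _ _ _ m1 m2 (m1 \x^ m2)%E)//.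
    by apply: eq_integral => y _; rewrite gee0_abs.
  by move=> C D mC mD; exact: product_measure2E.
move/(ae_eq_integral_abs _ measurableT _).1 => /(_ _)[].
  exact: measurable_fun_ysection.
by move=> S [mS S0 sub]; exists S; split => // y /= h; apply: sub => /= /(_ I).
Qed.

Lemma lipschitz_within_continuous (R : realType) (N : nat)
    (V : normedModType R) (A : set 'rV[R]_N) (f : 'rV[R]_N -> V) (c : R) :
  (forall x y, A x -> A y -> `|f x - f y| <= c * `|x - y|) ->
  {within A, continuous f}.
Proof.
move=> fc; apply/subspace_continuousP => x Ax.
apply/cvgrPdist_lt => e e0; rewrite near_withinE.
have c0 : 0 < `|c| + 1 by rewrite ltr_wpDl.
apply/nbhs_ballP; exists (e / (`|c| + 1)) => /=; first by rewrite divr_gt0.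
move=> y; rewrite -ball_normE /= ltr_pdivlMr// => xy Ay.
apply: le_lt_trans (fc _ _ Ax Ay) (le_lt_trans _ xy).
rewrite mulrC ler_wpM2l//; apply: le_trans (ler_norm _) _.
by rewrite lerDl.
Qed.

(** * Comparison of norms, countable bases and Borel sets *)

Section euclidean_norm.
Context {R : realType} {n : nat}.
Implicit Types x : 'rV[R]_n.

Lemma row_norm_le_enorm x : `|x| <= enorm x.
Proof.
apply: row_norm_le => [|i]; first exact: sqrtr_ge0.
rewrite -sqrtr_sqr; apply: ler_wsqrtr.
by rewrite (bigD1 i)//= lerDl sumr_ge0// => j _; rewrite sqr_ge0.
Qed.

(** The crude constant [n.+1], in place of the square root of [n], is positive even for [n = 0]. *)
Lemma enorm_le_row_norm x : enorm x <= n.+1%:R * `|x|.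
Proof.
rewrite -[leRHS]ger0_norm ?mulr_ge0// -sqrtr_sqr; apply: ler_wsqrtr.
apply: (@le_trans _ _ (\sum_(i < n) `|x| ^+ 2)).
  apply: ler_sum => i _; rewrite -[leLHS]real_normK ?num_real//.
  by apply: lerXn2r; rewrite ?nnegrE// row_coord_le.
rewrite sumr_const card_ord -[leLHS]mulr_natl exprMn ler_wpM2r ?sqr_ge0//.
by rewrite -natrX ler_nat -mulnn (leq_trans (leqnSn n))// leq_pmulr.
Qed.

End euclidean_norm.

Lemma exists_left_inverse (T U : pointedType) (A : set T) (f : T -> U) :
  set_inj A f -> exists g : U -> T, forall x, A x -> g (f x) = x.
Proof.
move=> injf.
have /choice[g hg] u : exists x, (exists2 y, A y & f y = u) -> A x /\ f x = u.
  have [[y Ay fy]|no] := pselect (exists2 y, A y & f y = u); first by exists y.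
  by exists point => /no.
exists g => x Ax; have [|Ag fg] := hg (f x); first by exists x.
by apply: injf => //; rewrite inE.
Qed.

(** Carries a lower bound from a dense sequence to a nearby point: [u] and [v] are the image
    distances to the sequence point and to the nearby one, [a] is the Lipschitz error and [w] a
    slack. *)
Lemma half_perturbation (R : realFieldType) (a w q u v : R) :
  a + w < q / 2 -> 0 <= w -> q <= u -> u <= v + a -> q / 2 <= v /\ u <= 2 * v.
Proof. by split; lra. Qed.

Section rational_balls.
Context {R : realType} {N : nat}.
Implicit Types (y z : 'rV[R]_N) (X : set 'rV[R]_N).

(** A countable base of the topology, enumerated through codes of pairs of a rational centre and an
    inverse radius; a number that codes no pair gives the empty set. *)
Definition rational_ball (n : nat) : set 'rV[R]_N :=
  if unpickle n is Some (q, m) then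
    [set z | `|map_mx (ratr : rat -> R) (q : 'rV[rat]_N) - z| < m.+1%:R^-1]
  else set0.

Lemma open_rational_ball n : open (rational_ball n).
Proof.
rewrite /rational_ball; case: unpickle => [[q m]|]; last exact: open0.
have := @ball_open R 'rV[R]_N (map_mx (ratr : rat -> R) q) m.+1%:R^-1.
by rewrite -ball_normE.
Qed.

Lemma rational_ball_basis y (e : R) : 0 < e ->
  exists2 n, rational_ball n y & forall z, rational_ball n z -> `|y - z| < e.
Proof.
move=> e0; have [m me] : exists m : nat, m.+1%:R^-1 <= e / 2.
  by apply: exists_invr_nat_le; rewrite divr_gt0.
have d0 : 0 < m.+1%:R^-1 :> R by rewrite invr_gt0.
have /choice[q hq] (i : 'I_N) : exists r : rat,
    `|ratr r - y ord0 i| < m.+1%:R^-1.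
  have : y ord0 i < y ord0 i + m.+1%:R^-1 by rewrite ltrDl.
  move=> /rat_in_itvoo[r]; rewrite in_itv/= => /andP[yr ry]; exists r.
  by rewrite ger0_norm ?subr_ge0 ?(ltW yr)// ltrBlDl.
pose v : 'rV[rat]_N := \row_i q i.
have vy : `|map_mx (ratr : rat -> R) v - y| < m.+1%:R^-1.
  by apply/row_norm_lt => // i; rewrite !mxE.
exists (pickle (v, m)); rewrite /rational_ball pickleK//= => z vz.
rewrite -(subrKA (map_mx (ratr : rat -> R) v)) (splitr e).
apply: le_lt_trans (ler_normD _ _) _; apply: ltrD; last exact: lt_le_trans me.
by rewrite distrC; exact: lt_le_trans me.
Qed.

Lemma exists_dense_seq X : exists d : nat -> 'rV[R]_N,
  forall y (e : R), X y -> 0 < e -> exists i, X (d i) /\ `|y - d i| < e.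
Proof.
have /choice[d hd] (n : nat) : exists u : 'rV[R]_N,
    (exists y, X y /\ rational_ball n y) -> X u /\ rational_ball n u.
  have [[y Xy]|no] := pselect (exists y, X y /\ rational_ball n y).
    by exists y.
  by exists 0 => /no.
exists d => y e Xy /(rational_ball_basis y)[n ny yn]; exists n.
have [Xd dn] : X (d n) /\ rational_ball n (d n) by apply: hd; exists y.
by split => //; exact: yn.
Qed.

(** Open sets are the generators of [borel_rV]. *)
Lemma open_measurable_rV X : open X -> measurable (X : set (borel_rV R N)).
Proof. by move=> oX; exact: sub_sigma_algebra. Qed.

Lemma closed_measurable_rV X : closed X -> measurable (X : set (borel_rV R N)).
Proof.
move=> cX; have := measurableC (open_measurable_rV (closed_openC cX)).
by rewrite setCK.
Qed.

(** Every point off the support has a null open neighbourhood, hence lies in a null rational ball,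
    and there are only countably many of these. *)
Lemma measure_support_full (mu : {measure set (borel_rV R N) -> \bar R}) :
  mu (~` measure_support mu) = 0%E.
Proof.
pose B (n : nat) : set (borel_rV R N) :=
  if mu (rational_ball n) == 0%E then rational_ball n else set0.
have mB n : measurable (B n).
  rewrite /B; case: ifP => // _; apply: open_measurable_rV.
  exact: open_rational_ball.
have cS : closed (measure_support mu).
  by apply: closed_bigI => F [].
apply: measure_negligible.
  by apply: measurableC; exact: closed_measurable_rV.
apply: (@negligibleS _ _ _ _ (\bigcup_n B n)); last first.
  apply: negligible_bigcup => n; apply/negligibleP => //.
  by rewrite /B; case: ifP => [/eqP //|_]; rewrite measure0.
move=> y /= /existsNP[F /not_implyP[[cF muF] Fy]].
have : nbhs y (~` F) by apply: open_nbhs_nbhs; split => //; exact: closed_openC.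
move=> /nbhs_ballP[e /= e0 eF]; have [n ny yn] := rational_ball_basis y e0.
exists n => //; rewrite /B ifT//.
rewrite -measure_le0 -muF; apply: le_measure; rewrite ?inE.
- by apply: open_measurable_rV; exact: open_rational_ball.
- by apply: measurableC; exact: closed_measurable_rV.
- by move=> z /yn yz; apply: eF; rewrite -ball_normE.
Qed.

End rational_balls.

Lemma measurable_set_ltr d (T : measurableType d) (R : realType) (D : set T)
    (f g : T -> R) :
  measurable D -> measurable_fun D f -> measurable_fun D g ->
  measurable (D `&` [set x | f x < g x]).
Proof.
move=> mD mf mg; under eq_set => x do rewrite -lte_fin.
by apply: measurable_lte => //; exact: measurableT_comp.
Qed.

Lemma measurable_fun_bigmaxr d (T : measurableType d) (R : realType) (D : set T)
    (I : Type) (s : seq I) (f : I -> T -> R) :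
  (forall i, measurable_fun D (f i)) ->
  measurable_fun D (fun x => \big[Num.max/0]_(i <- s) f i x).
Proof.
move=> mf; elim: s => [|i s IH].
  by under eq_fun do rewrite big_nil; exact: measurable_cst.
by under eq_fun do rewrite big_cons; exact: measurable_maxr.
Qed.

Lemma row_normE (R : realType) n (x : 'rV[R]_n) :
  `|x| = \big[Num.max/0]_(i < n) `|x ord0 i|.
Proof.
apply/eqP; rewrite eq_le; apply/andP; split.
  apply: row_norm_le => [|i]; first by apply/bigmax_geP; left.
  by apply/bigmax_geP; right; exists i.
by apply/bigmax_leP; split=> // i _; exact: row_coord_le.
Qed.

Lemma measurable_coord_rV (R : realType) N (i : 'I_N) :
  measurable_fun [set: borel_rV R N] (fun x : 'rV[R]_N => x ord0 i).
Proof.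
apply: (measurability _ (RGenOInfty.measurableE R)).
move=> _ [_ [a ->] <-]; rewrite setTI; apply: open_measurable_rV.
rewrite set_itvoy; apply: open_comp; last exact: open_gt.
by move=> x _; exact: coord_continuous.
Qed.

(** * The two exceptional sets *)

Section fixed_point_estimates.
Context {R : realType} {N k : nat}.
Local Notation T := ((N * k).-tuple (measurableTypeR R)).
Local Notation leb := (lebesgue_tuple R (N * k)).
Variables (X : set 'rV[R]_N) (phi : 'rV[R]_N -> 'rV[R]_k) (lip : R).
Hypothesis lip_ge0 : 0 <= lip.
Hypothesis phi_lip :
  forall x y, X x -> X y -> `|phi x - phi y| <= lip * `|x - y|.
Implicit Types (t : T) (x y : 'rV[R]_N) (b r : R).

Definition image_dist t x y : R :=
  `|(phi \+ lin_of_coords t) x - (phi \+ lin_of_coords t) y|.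

Lemma image_distE t x y :
  image_dist t x y = `|lin_of_coords t (x - y) + (phi x - phi y)|.
Proof.
rewrite linearB; congr `|_|.
rewrite [X in X - _](_ : _ = phi x + lin_of_coords t x)// opprD addrACA.
by rewrite [RHS]addrC.
Qed.

Lemma image_dist_ge0 t x y : 0 <= image_dist t x y.
Proof. exact: normr_ge0. Qed.

Lemma coord_box_norm_le t b z : 0 <= b -> coord_box b t ->
  `|lin_of_coords t z| <= N%:R * b * `|z|.
Proof.
move=> b0 tb; apply: row_norm_le => [|j]; first by rewrite !mulr_ge0.
rewrite lin_of_coordsE; apply: le_trans (ler_norm_sum _ _ _) _.
apply: (@le_trans _ _ (\sum_(i < N) b * `|z|)).
  by apply: ler_sum => i _; rewrite normrM mulrC ler_pM// row_coord_le.
by rewrite sumr_const card_ord -mulrA mulr_natl.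
Qed.

Lemma image_dist_lip t b x y y' : 0 <= b -> coord_box b t -> X y -> X y' ->
  image_dist t x y <= image_dist t x y' + (lip + N%:R * b) * `|y - y'|.
Proof.
move=> b0 tb Xy Xy'; rewrite /image_dist.
set f := phi \+ _; rewrite -[f x - f y](subrKA (f y')).
apply: le_trans (ler_normD _ _) _; rewrite lerD2l distrC.
have -> : f y - f y' = (phi y - phi y') + lin_of_coords t (y - y').
  rewrite linearB [f y](_ : _ = phi y + lin_of_coords t y)//.
  by rewrite opprD addrACA.
rewrite mulrDl; apply: le_trans (ler_normD _ _) _; apply: lerD.
  exact: phi_lip.
exact: coord_box_norm_le.
Qed.

Lemma exists_coord_box t : exists n : nat, coord_box n%:R t.
Proof.
exists (\sum_i (Num.truncn `|tnth t i|).+1)%N => i.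
apply: (@le_trans _ _ (Num.truncn `|tnth t i|).+1%:R); first exact/ltW/truncnS_gt.
by rewrite ler_nat (bigD1 i)//= leq_addr.
Qed.

(** In each piece meeting [Y] one point [y0] is fixed. If some [y] in the piece has image within
    [delta i] of that of [x], then so has [y0] up to a constant factor, which confines [t] to a
    slab. The constant [C] depends on neither [x], [r] nor the cover. *)
Lemma cover_slab b : 0 <= b -> exists2 C, 0 <= C &
  forall x r (Y : set 'rV[R]_N) (U : nat -> set 'rV[R]_N) (delta : nat -> R),
    X x -> 0 < r -> Y `<=` X -> (forall y, Y y -> r <= `|x - y|) ->
    (forall i, 0 <= delta i) ->
    (forall i y y', U i y -> U i y' -> `|y - y'| <= delta i) ->
    exists S : set T, [/\ measurable S,
      [set t | coord_box b t /\
        exists i y, [/\ Y y, U i y & image_dist t x y <= delta i]] `<=` S &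
      (leb S <= \sum_(0 <= i <oo) (C * (delta i / r) ^+ k)%:E)%E].
Proof.
(* The 1 accounts for the image distance of [y], the rest for moving from [y] to [y0]. *)
move=> b0; pose K := lip + N%:R * b + 1.
have K0 : 0 <= K by rewrite !addr_ge0// mulr_ge0.
exists ((2 * b) ^+ (k * N.-1) * (2 * K) ^+ k).
  by rewrite mulr_ge0// exprn_ge0// mulr_ge0.
move=> x r Y U delta Xx r0 YX rY delta0 diamU.
set C := _ * _ ^+ k.
have C0 : 0 <= C by rewrite mulr_ge0// exprn_ge0// mulr_ge0.
have /choice[S hS] i : exists S : set T, [/\ measurable S,
    [set t | coord_box b t /\
      exists y, [/\ Y y, U i y & image_dist t x y <= delta i]] `<=` S &
    (leb S <= (C * (delta i / r) ^+ k)%:E)%E].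
  have [[y0 [Yy0 Uy0]]|noy] := pselect (exists y, Y y /\ U i y); last first.
    exists set0; split => //.
      by move=> t [_ [y [Yy Uy _]]]; apply: noy; exists y.
    by rewrite measure0 lee_fin mulr_ge0// exprn_ge0// divr_ge0// ltW.
  have [S [mS subS leS]] := lin_slab_measure_le (phi x - phi y0) r0 (rY _ Yy0) b0
    (mulr_ge0 K0 (delta0 i)).
  exists S; split => //.
    move=> t [tb [y [Yy Uy ty]]]; apply: subS; split => //=.
    rewrite -image_distE.
    apply: le_trans (image_dist_lip x b0 tb (YX _ Yy0) (YX _ Yy)) _.
    rewrite /K [leRHS]mulrDl mul1r addrC lerD// ler_wpM2l//.
      by rewrite addr_ge0// mulr_ge0.
    exact: diamU.
  apply: le_trans leS _; rewrite lee_fin /C -[leRHS]mulrA -exprMn.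
  by rewrite !mulrA.
exists (\bigcup_i S i); split.
- by apply: bigcupT_measurable => i; have [] := hS i.
- move=> t [tb [i [y Hy]]]; exists i => //; have [_ + _] := hS i; apply.
  by split => //; exists y.
apply: le_trans (measure_sigma_subadditive _ _ _ (@subset_refl _ _)) _ => //=.
- by move=> i; have [] := hS i.
- by apply: bigcupT_measurable => i; have [] := hS i.
- by apply: lee_nneseries => // i _; have [] := hS i.
Qed.

(** The event is a countable union over bounded maps and separation at least [m.+1%:R^-1]; on each
    piece covers with small sum make its measure arbitrarily small. *)
Lemma coincidence_negligible x : null_covered k X -> X x ->
  leb.-negligible [set t | exists y, [/\ X y, y != x & image_dist t x y = 0]].
Proof.
move=> Xk Xx.
apply: (@negligibleS _ _ _ _ (\bigcup_m [set t | coord_box m%:R t /\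
    exists y, [/\ X y, m.+1%:R^-1 <= `|x - y| & image_dist t x y = 0]])).
  move=> t [y [Xy yx ty]]; have [n tn] := exists_coord_box t.
  have [m my] : exists m : nat, m.+1%:R^-1 <= `|x - y|.
    by apply: exists_invr_nat_le; rewrite normr_gt0 subr_eq0 eq_sym.
  exists (maxn n m) => //; split.
    by move=> i; apply: le_trans (tn i) _; rewrite ler_nat leq_maxl.
  exists y; split => //; apply: le_trans my.
  by rewrite lef_pV2 ?posrE// ler_nat ltnS leq_maxr.
apply: negligible_bigcup => m; apply: negligible_le_eps => eps eps0.
have [C C0 hC] := cover_slab (ler0n R m).
pose r : R := m.+1%:R^-1.
have r0 : 0 < r by rewrite invr_gt0.
(* With this choice the bound becomes [C / (C + 1) * eps]; adding 1 allows for [C = 0]. *)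
have eta0 : 0 < eps / (C + 1) * r ^+ k.
  by rewrite mulr_gt0 ?exprn_gt0// divr_gt0// ltr_wpDl.
have [U [delta [XU delta0 diamU sumU]]] := Xk _ eta0.
have [S [mS subS leS]] := hC x r [set y | X y /\ r <= `|x - y|] U delta Xx r0
  (fun y => @proj1 _ _) (fun y => @proj2 _ _) delta0 diamU.
exists S; split => //.
  move=> t [tm [y [Xy ry ty]]]; apply: subS; split => //.
  have [i _ Uy] := XU _ Xy.
  by exists i, y; split => //; rewrite ty.
apply: le_trans leS _.
under eq_eseriesr do rewrite expr_div_n mulrA mulrAC EFinM.
rewrite nneseriesZl; last by move=> i _; rewrite lee_fin exprn_ge0.
apply: (@le_trans _ _ ((C / r ^+ k)%:E * (eps / (C + 1) * r ^+ k)%:E)%E).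
  by rewrite lee_wpmul2l// lee_fin divr_ge0// exprn_ge0// ltW.
rewrite -EFinM lee_fin.
have rk0 : r ^+ k != 0 by rewrite expf_neq0// gt_eqF.
rewrite (_ : _ * _ * (_ * _) = (C / (C + 1)) * eps); last first.
  move: (r ^+ k) rk0 => rk rk0.
  by field; rewrite rk0/= gt_eqF// ltr_wpDl.
by rewrite ler_piMl ?(ltW eps0)// ler_pdivrMr ?ltr_wpDl// mul1r lerDl.
Qed.

(** Approaches at arbitrarily small distances visit infinitely many dyadic shells, so [t] lies in
    the upper limit of the events [E b n] for some [b]. *)
Lemma close_approach_negligible (alpha : R) x :
  (0 < k)%N -> 0 < alpha -> ball_covered k alpha X x -> X x ->
  leb.-negligible [set t | forall j : nat, exists y,
    [/\ X y, 0 < `|x - y| < 2 ^- j &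
        image_dist t x y < `|x - y| `^ alpha^-1]].
Proof.
move=> k_gt0 al0 [C [theta [n0 [C0 th hcov]]]] Xx.
pose E (b n : nat) : set T := [set t | coord_box b%:R t /\
  exists y, [/\ X y, 2 ^- n.+1 <= `|x - y| < 2 ^- n &
    image_dist t x y <= (2 ^- n) `^ alpha^-1]].
apply: (@negligibleS _ _ _ _ (\bigcup_b lim_sup_set (E b))).
  move=> t ht; have [b tb] := exists_coord_box t.
  exists b => // j _; have [y [Xy /andP[xy0 xyj] ty]] := ht j.
  have [n jn /andP[ny yn]] := exists_dyadic_shell xy0 xyj.
  exists n => //; split => //; exists y; split; rewrite ?ny//.
  apply/ltW/(lt_le_trans ty); apply: ge0_ler_powR.
  - by rewrite invr_ge0 ltW.
  - by rewrite nnegrE.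
  - by rewrite nnegrE.
  - exact: ltW.
apply: negligible_bigcup => b.
have [D D0 hD] := cover_slab (ler0n R b).
apply: (@negligible_limsup_geometric _ _ _ _ _ n0 (D * 2 ^+ k * C) theta) => //.
  by rewrite mulr_ge0// mulr_ge0.
move=> n n0n; have [M [[U [XU diamU]] MC]] := hcov n n0n.
pose rho : R := (2 ^- n) `^ alpha^-1.
have rho0 : 0 <= rho by exact: powR_ge0.
(* Pieces from [M] on are emptied and given size 0, which costs nothing in the sum because
   [k > 0]. *)
pose V i := if (i < M)%N then U i else set0.
pose delta i := if (i < M)%N then rho else 0.
have r0 : 0 < 2 ^- n.+1 :> R by rewrite invr_gt0 exprn_gt0.
have delta0 i : 0 <= delta i by rewrite /delta; case: ifP.
have diamV i y y' : V i y -> V i y' -> `|y - y'| <= delta i.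
  by rewrite /V /delta; case: ifP => // _; exact: diamU.
have [S [mS subS leS]] := hD x _
  [set y | X y /\ 2 ^- n.+1 <= `|x - y| < 2 ^- n] V delta Xx r0
  (fun y => @proj1 _ _) (fun y h => proj1 (andP (proj2 h))) delta0 diamV.
exists S; split => //.
  move=> t [tb [y [Xy /[dup] /andP[ny yn] nyn ty]]]; apply: subS; split => //.
  have [i iM Uy] := XU _ (conj Xy yn).
  by exists i, y; rewrite /V /delta iM.
apply: le_trans leS _.
have u0 i : 0 <= D * (delta i / 2 ^- n.+1) ^+ k.
  by rewrite mulr_ge0// exprn_ge0// divr_ge0// ltW.
rewrite (nneseries_finite_support (M := M))//; last first.
  move=> i Mi; rewrite /delta ltnNge Mi/= mul0r expr0n.
  by rewrite (gtn_eqF k_gt0) mulr0.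
rewrite lee_fin.
under eq_bigr do rewrite /delta ltn_ord /=.
rewrite sumr_const card_ord -[leLHS]mulr_natl.
apply: (@le_trans _ _ (D * 2 ^+ k * (M%:R * (2 ^+ n * rho) ^+ k))).
  have -> : rho / 2 ^- n.+1 = 2 * (2 ^+ n * rho).
    by rewrite invrK exprS mulrC mulrA.
  by rewrite exprMn le_eqVlt; apply/orP; left; apply/eqP; ring.
by rewrite -[leRHS]mulrA ler_wpM2l// mulr_ge0.
Qed.
(** Only the restriction of [phi] to [X] is controlled, so a superlevel set is written as the trace
    on [X] of an open set: the union of balls around its points so small that the Lipschitz bound
    keeps the coordinate above [a]. *)
Lemma measurable_lipschitz_coord (j : 'I_k) :
  measurable (X : set (borel_rV R N)) ->
  measurable_fun (X : set (borel_rV R N)) (fun x : 'rV[R]_N => phi x ord0 j).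
Proof.
move=> mX; apply: (measurability _ (RGenOInfty.measurableE R)).
move=> _ [_ [a ->] <-]; rewrite set_itvoy.
pose O := \bigcup_(d in [set d | X d /\ a < phi d ord0 j])
  (ball d ((phi d ord0 j - a) / (lip + 1)) : set 'rV[R]_N).
have lip1 : 0 < lip + 1 by rewrite ltr_wpDl.
rewrite (_ : _ `&` _ = X `&` O).
  apply: measurableI => //; apply: open_measurable_rV.
  apply: bigcup_open => d [_ ad].
  by apply: ball_open.
apply/seteqP; split=> x [Xx] /= h; split=> //.
  exists x => //; apply: ballxx.
  by rewrite divr_gt0// subr_gt0.
case: h => d [Xd ad].
rewrite -ball_normE /= ltr_pdivlMr// => dx.
have : `|phi d ord0 j - phi x ord0 j| <= lip * `|d - x|.
  apply: le_trans (phi_lip Xd Xx).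
  by have := row_coord_le (phi d - phi x) j; rewrite !mxE.
rewrite mulrDr mulr1 [_ * lip]mulrC in dx => h /=.
have := ler_norm (phi d ord0 j - phi x ord0 j); have := normr_ge0 (d - x); lra.
Qed.

Local Notation PT := (borel_rV R N * T)%type.

Lemma measurable_image_dist (d : 'rV[R]_N) :
  measurable (X : set (borel_rV R N)) ->
  measurable_fun ((X : set (borel_rV R N)) `*` [set: T])
    (fun p : PT => image_dist p.2 p.1 d).
Proof.
move=> mX; under eq_fun do rewrite image_distE row_normE.
apply: measurable_fun_bigmaxr => j; apply: measurableT_comp => //.
have mP : measurable ((X : set (borel_rV R N)) `*` [set: T]).
  exact: measurableX.
rewrite [X in measurable_fun _ X](_ : _ = (fun p : PT =>
  (\sum_(i < N) (p.1 ord0 i - d ord0 i) * tnth p.2 (mxvec_index i j)) +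
  (phi p.1 ord0 j - phi d ord0 j))); last first.
  apply/funext => p; rewrite mxE lin_of_coordsE !mxE; congr (_ + _).
  by apply: eq_bigr => i _; rewrite !mxE.
apply: measurable_funD.
  apply: (measurable_funS measurableT) => //.
  apply: measurable_sum => i; apply: measurable_funM.
    apply: measurable_funB => //.
    exact: (measurableT_comp (measurable_coord_rV i) measurable_fst).
  exact: (measurableT_comp (measurable_tnth _) measurable_snd).
apply: measurable_funB => //.
apply: (measurable_comp mX) (measurable_lipschitz_coord j mX) _.
  by move=> _ [p [/= Xp _] <-].
exact: (measurable_funS measurableT _ measurable_fst).
Qed.

Lemma measurable_norm_diff (d : 'rV[R]_N) :
  measurable_fun [set: PT] (fun p : PT => `|(p.1 : 'rV[R]_N) - d|).
Proof.
under eq_fun do rewrite row_normE.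
apply: measurable_fun_bigmaxr => i; apply: measurableT_comp => //.
under eq_fun do rewrite !mxE.
apply: measurable_funB => //.
exact: (measurableT_comp (measurable_coord_rV i) measurable_fst).
Qed.

Variable d : nat -> 'rV[R]_N.

(* The pairs [(x, t)] for which points of [X] far from [x] have images
   arbitrarily close to that of [x].  Testing only the points of a dense
   sequence makes this set and the next one measurable. *)
Definition collapsing : set PT := [set p | X p.1 /\
  exists l : nat, forall m : nat, exists i, [/\ X (d i),
    l.+1%:R^-1 < `|p.1 - d i| & image_dist p.2 p.1 (d i) < m.+1%:R^-1]].

Definition non_holder (alpha : R) : set PT := [set p | X p.1 /\
  forall c : nat, exists i, X (d i) /\
    c%:R * image_dist p.2 p.1 (d i) `^ alpha < `|p.1 - d i|].

Lemma measurable_collapsing :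
  measurable (X : set (borel_rV R N)) -> measurable collapsing.
Proof.
move=> mX; set P : set PT := (X : set (borel_rV R N)) `*` [set: T].
have mP : measurable P by exact: measurableX.
rewrite (_ : collapsing = \bigcup_l \bigcap_m \bigcup_(i in [set i | X (d i)])
  ((P `&` [set p | l.+1%:R^-1 < `|p.1 - d i|]) `&`
   (P `&` [set p | image_dist p.2 p.1 (d i) < m.+1%:R^-1]))).
  apply: bigcupT_measurable => l; apply: bigcapT_measurable => m.
  apply: bigcup_measurable => i _; apply: measurableI;
    apply: measurable_set_ltr => //.
  - by apply: (measurable_funS measurableT) => //; exact: measurable_norm_diff.
  - exact: measurable_image_dist.
apply/seteqP; split=> [p [Xp [l h]]|p [l _ h]].
  by exists l => // m _; have [i [Xi h1 h2]] := h m; exists i.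
split; first by have [i Xi [[[]]]] := h 0%N I.
by exists l => m; have [i Xi [[_ h1] [_ h2]]] := h m I; exists i.
Qed.

Lemma measurable_non_holder (alpha : R) :
  measurable (X : set (borel_rV R N)) -> measurable (non_holder alpha).
Proof.
move=> mX; set P : set PT := (X : set (borel_rV R N)) `*` [set: T].
have mP : measurable P by exact: measurableX.
rewrite (_ : non_holder alpha = \bigcap_c \bigcup_(i in [set i | X (d i)])
  (P `&` [set p | c%:R * image_dist p.2 p.1 (d i) `^ alpha < `|p.1 - d i|])).
  apply: bigcapT_measurable => c.
  apply: bigcup_measurable => i _; apply: measurable_set_ltr => //.
  - apply: measurable_funM => //.
    apply: (measurableT_comp (measurable_powR alpha)).
    exact: measurable_image_dist.
  - by apply: (measurable_funS measurableT) => //; exact: measurable_norm_diff.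
apply/seteqP; split=> [p [Xp h] c _|p h].
  by have [i [Xi hi]] := h c; exists i.
split; first by have [i Xi [[]]] := h 0%N I.
by move=> c; have [i Xi [_ hi]] := h c I; exists i.
Qed.

(** The image distance from [x] is continuous on the compact part of [X] at distance at least [r],
    so its set of values is closed; it omits 0, hence a neighbourhood of 0. *)
Lemma compact_separation t x : compact X -> X x ->
  (forall y, X y -> image_dist t x y = 0 -> y = x) ->
  forall r, 0 < r -> exists2 e, 0 < e &
    forall y, X y -> r <= `|x - y| -> e <= image_dist t x y.
Proof.
move=> cX Xx inj r r0.
pose Y := X `&` [set y | r <= `|x - y|].
have cY : compact Y.
  apply: compact_closedI => //.
  rewrite (_ : [set y | _] = ~` ball x r); last first.
    by apply/seteqP; rewrite -ball_normE; split=> y /=; rewrite leNgt => /negP.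
  by apply: open_closedC; exact: ball_open.
have [n tn] := exists_coord_box t.
have contY : {within Y, continuous (image_dist t x)}.
  apply: (@lipschitz_within_continuous _ _ _ _ _ (lip + N%:R * n%:R)).
  move=> y y' [Xy _] [Xy' _].
  rewrite ler_distl lerBlDr; apply/andP; split; last first.
    exact: (image_dist_lip x (ler0n R n) tn).
  by rewrite distrC; exact: (image_dist_lip x (ler0n R n) tn).
have cF : closed (image_dist t x @` Y).
  by apply: compact_closed; [exact: Rhausdorff|exact: continuous_compact].
have : nbhs (0 : R) (~` (image_dist t x @` Y)).
  apply: open_nbhs_nbhs; split; first exact: closed_openC.
  move=> [y [Xy ry] y0]; have yx := inj _ Xy y0.
  by move: ry; rewrite /= yx subrr normr0 leNgt r0.
move=> /nbhs_ballP[e /= e0 eF]; exists e => // y Xy ry.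
rewrite leNgt; apply/negP => ye.
have : (~` (image_dist t x @` Y)) (image_dist t x y).
  by apply: eF; rewrite -ball_normE /= sub0r normrN ger0_norm ?image_dist_ge0.
by apply; exists y.
Qed.

(** By compactness a collapse at [x] forces an exact coincidence of images, which is a null
    event. *)
Lemma collapsing_section_negligible x :
  compact X -> null_covered k X ->
  leb.-negligible (xsection (collapsing) x).
Proof.
move=> cX Xk; have [Xx|nXx] := pselect (X x); last first.
  rewrite (_ : xsection _ _ = set0); first exact: negligible_set0.
  by apply/seteqP; split => // t; rewrite xsectionE /= => -[].
apply: negligibleS (coincidence_negligible Xk Xx) => t.
rewrite xsectionE /= => -[_ [l hl]]; apply: contrapT => no.
have inj y : X y -> image_dist t x y = 0 -> y = x.
  move=> Xy y0; apply: contrapT => /eqP yx.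
  by apply: no; exists y.
have l0 : 0 < l.+1%:R^-1 :> R by rewrite invr_gt0.
have [e e0 he] := compact_separation cX Xx inj l0.
have [m me] := exists_invr_nat_le e0.
have [i [Xi li im]] := hl m.
have := he _ Xi (ltW li); rewrite leNgt => /negP; apply.
exact: lt_le_trans me.
Qed.

(** Without a coincidence, points far from [x] have images bounded away from that of [x]. Failure of
    the bound for large [c] therefore takes place arbitrarily close to [x]. *)
Lemma non_holder_section_negligible (alpha : R) x :
  (0 < k)%N -> 0 < alpha -> compact X -> null_covered k X ->
  (X x -> ball_covered k alpha X x) ->
  leb.-negligible (xsection (non_holder alpha) x).
Proof.
move=> k_gt0 al0 cX Xk Xball; have [Xx|nXx] := pselect (X x); last first.
  rewrite (_ : xsection _ _ = set0); first exact: negligible_set0.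
  by apply/seteqP; split => // t; rewrite xsectionE /= => -[].
apply: negligibleS (negligibleU
  (coincidence_negligible Xk Xx)
  (close_approach_negligible k_gt0 al0 (Xball Xx) Xx)) => t.
rewrite xsectionE /= => -[_ hc].
have [|no] :=
  pselect ([set t | exists y, [/\ X y, y != x & image_dist t x y = 0]] t).
  by left.
right => j /=.
have inj y : X y -> image_dist t x y = 0 -> y = x.
  by move=> Xy y0; apply: contrapT => /eqP yx; apply: no; exists y.
have j0 : 0 < 2 ^- j :> R by rewrite invr_gt0 exprn_gt0.
have [e e0 he] := compact_separation cX Xx inj j0.
have [D [_ hD]] := compact_bounded cX.
pose B := `|D| + 1.
have XB y : X y -> `|y| <= B.
  by apply: hD; rewrite (le_lt_trans (ler_norm _))// ltrDl.
have ea0 : 0 < e `^ alpha by exact: powR_gt0.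
(* Large enough for the bound to hold automatically at distance at least [2 ^- j], since points of
   [X] are at most [B + B] apart; also at least 1, as used at the end. *)
pose c := (Num.truncn ((B + B) / e `^ alpha)).+1.
have [i [Xi ci]] := hc c; exists (d i).
have F0 := image_dist_ge0 t x (d i).
have di0 : 0 < `|x - d i|.
  by apply: le_lt_trans ci; rewrite mulr_ge0// powR_ge0.
split => //.
- rewrite di0 /= ltNge; apply/negP => jd.
  move: ci; apply/negP; rewrite -leNgt.
  apply: (@le_trans _ _ (B + B)).
    by apply: le_trans (ler_normB _ _) _; apply: lerD; exact: XB.
  rewrite -ler_pdivrMr; last by apply: powR_gt0; exact: lt_le_trans e0 (he _ Xi jd).
  apply: (@le_trans _ _ ((B + B) / e `^ alpha)); last exact/ltW/truncnS_gt.
  rewrite ler_wpM2l//; first by rewrite !addr_ge0.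
  rewrite lef_pV2 ?posrE//; last first.
    by apply: powR_gt0; exact: lt_le_trans e0 (he _ Xi jd).
  apply: ge0_ler_powR; rewrite ?nnegrE// ?(ltW al0)// ?(ltW e0)//.
  exact: he.
have -> : image_dist t x (d i) = (image_dist t x (d i) `^ alpha) `^ alpha^-1.
  by rewrite -powRrM divff ?gt_eqF// powRr1.
apply: gt0_ltr_powR; rewrite ?invr_gt0// ?nnegrE ?powR_ge0//.
apply: le_lt_trans ci; rewrite ler_peMl ?powR_ge0//.
by rewrite ler1n.
Qed.

Hypothesis d_dense :
  forall y e, X y -> 0 < e -> exists i, X (d i) /\ `|y - d i| < e.

(** The bound is known along the dense sequence and passes to [X] because the image distance is
    Lipschitz in its second point. *)
Lemma not_collapsing_separation t x : X x -> ~ collapsing (x, t) ->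
  forall r, 0 < r -> exists2 e, 0 < e &
    forall y, X y -> r <= `|x - y| -> e <= image_dist t x y.
Proof.
move=> Xx nc r r0.
have [l lr] : exists l : nat, l.+1%:R^-1 <= r / 2.
  by apply: exists_invr_nat_le; rewrite divr_gt0.
have [m hm] : exists m : nat, forall i, X (d i) -> l.+1%:R^-1 < `|x - d i| ->
    m.+1%:R^-1 <= image_dist t x (d i).
  apply: contrapT => no; apply: nc; split => //; exists l => m.
  apply: contrapT => no'; apply: no; exists m => i Xi li.
  by rewrite leNgt; apply/negP => im; apply: no'; exists i.
have [b tb] := exists_coord_box t.
pose K := lip + N%:R * b%:R + 1.
have K0 : 0 < K by rewrite ltr_wpDl// addr_ge0// mulr_ge0.
have m0 : 0 < m.+1%:R^-1 :> R by rewrite invr_gt0.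
exists (m.+1%:R^-1 / 2) => [|y Xy ry]; first by rewrite divr_gt0.
(* The first bound keeps [d i] far enough from [x]; the second makes the Lipschitz error less than
   half of the lower bound. *)
have [|i [Xi]] := @d_dense y (Num.min (r / 2) (m.+1%:R^-1 / 2 / K)) Xy.
  by rewrite lt_min !divr_gt0.
rewrite lt_min => /andP[yi1 yi2].
have xi : l.+1%:R^-1 < `|x - d i|.
  apply: le_lt_trans lr _.
  rewrite -[ltLHS](addrK (r / 2)) -splitr ltrBlDr.
  apply: le_lt_trans (le_trans ry (ler_distD (d i) x y)) _.
  by rewrite ltrD2l distrC.
have lipF := image_dist_lip x (ler0n R b) tb Xi Xy.
rewrite distrC in lipF; rewrite ltr_pdivlMr// /K mulrDr mulr1 mulrC in yi2.
by have [] := half_perturbation yi2 (normr_ge0 _) (hm _ Xi xi) lipF.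
Qed.

Lemma not_non_holder_bound t x alpha : 0 < alpha -> X x ->
  ~ non_holder alpha (x, t) ->
  exists2 c, 0 < c & forall y, X y -> `|x - y| <= c * image_dist t x y `^ alpha.
Proof.
move=> al0 Xx nc.
have [c hc] : exists c : nat, forall i, X (d i) ->
    `|x - d i| <= c%:R * image_dist t x (d i) `^ alpha.
  apply: contrapT => no; apply: nc; split => // c.
  apply: contrapT => no'; apply: no; exists c => i Xi.
  by rewrite leNgt; apply/negP => ic; apply: no'; exists i.
have {}hc i : X (d i) -> `|x - d i| <= c.+1%:R * image_dist t x (d i) `^ alpha.
  move=> Xi; apply: le_trans (hc _ Xi) _.
  by rewrite ler_wpM2r ?powR_ge0// ler_nat.
have [b tb] := exists_coord_box t.
pose K := lip + N%:R * b%:R + 1.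
have K0 : 0 < K by rewrite ltr_wpDl// addr_ge0// mulr_ge0.
(* The factor 2 pays for replacing the distance to [y] by that to [d i], and the power of 2 for the
   corresponding image distances. *)
exists (2 * c.+1%:R * 2 `^ alpha) => [|y Xy].
  by rewrite !mulr_gt0// powR_gt0.
have [->|yx] := eqVneq y x.
  by rewrite subrr normr0 mulr_ge0 ?powR_ge0// !mulr_ge0// powR_ge0.
have del0 : 0 < `|x - y| by rewrite normr_gt0 subr_eq0 eq_sym.
set del := `|x - y| in del0 *.
pose f0 := (del / (2 * c.+1%:R)) `^ alpha^-1.
have f00 : 0 < f0 by rewrite powR_gt0// divr_gt0// mulr_gt0.
have [|i [Xi]] := @d_dense y (Num.min (del / 2) (f0 / 2 / K)) Xy.
  by rewrite lt_min !divr_gt0.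
rewrite lt_min => /andP[yi1 yi2].
have xi : del / 2 <= `|x - d i|.
  rewrite -[leLHS](addrK (del / 2)) -splitr lerBlDr.
  apply: le_trans (ler_distD (d i) x y) _.
  by rewrite lerD2l [leLHS]distrC ltW.
have cF : del / 2 <= c.+1%:R * image_dist t x (d i) `^ alpha.
  exact: le_trans xi (hc _ Xi).
have fF : f0 <= image_dist t x (d i).
  have -> : image_dist t x (d i) = (image_dist t x (d i) `^ alpha) `^ alpha^-1.
    by rewrite -powRrM divff ?gt_eqF// powRr1// image_dist_ge0.
  apply: ge0_ler_powR.
  - by rewrite invr_ge0 ltW.
  - by rewrite nnegrE divr_ge0 ?(ltW del0)// mulr_ge0.
  - by rewrite nnegrE powR_ge0.
  - by rewrite invfM mulrA ler_pdivrMr// [leRHS]mulrC.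
have F2 : image_dist t x (d i) <= 2 * image_dist t x y.
  have lipF := image_dist_lip x (ler0n R b) tb Xi Xy.
  rewrite distrC in lipF; rewrite ltr_pdivlMr// /K mulrDr mulr1 mulrC in yi2.
  by have [] := half_perturbation yi2 (normr_ge0 _) fF lipF.
apply: (@le_trans _ _ (2 * c.+1%:R * image_dist t x (d i) `^ alpha)).
  by rewrite -mulrA -ler_pdivrMl// mulrC.
rewrite -[leRHS]mulrA; apply: ler_wpM2l; first by rewrite mulr_ge0.
rewrite -(@powRM _ 2 _ alpha) ?image_dist_ge0//.
apply: ge0_ler_powR => //; rewrite ?nnegrE ?image_dist_ge0//; first exact: ltW.
by rewrite mulr_ge0// image_dist_ge0.
Qed.

End fixed_point_estimates.

(** * Almost every projection *)

Section almost_every_projection.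
Context {R : realType} {N k : nat}.
Variables (X : set 'rV[R]_N) (phi : 'rV[R]_N -> 'rV[R]_k) (lip : R).
Hypothesis lip_ge0 : 0 <= lip.
Hypothesis phi_lip :
  forall x y, X x -> X y -> `|phi x - phi y| <= lip * `|x - y|.
Variable mu : {finite_measure set (borel_rV R N) -> \bar R}.
Hypotheses (X_compact : compact X) (X_full : mu (~` X) = 0%E).
Hypothesis X_null : null_covered k X.

Let mX : measurable (X : set (borel_rV R N)).
Proof. by apply: closed_measurable_rV; exact: compact_closed. Qed.

(** Removing the null section of [collapsing] leaves points where distance at least [r] forces image
    distance at least some [e]; this gives injectivity and continuity of the inverse. *)
Lemma ae_continuous_inverse :
  ae_lin (fun L : {linear 'rV[R]_N -> 'rV[R]_k} =>
    exists XL : set (borel_rV R N),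
      [/\ measurable XL, XL `<=` X, mu (~` XL) = 0%E,
          set_inj XL (phi \+ L) &
          exists2 psi : 'rV[R]_k -> 'rV[R]_N,
            {in XL, cancel (phi \+ L) psi} &
            {within (phi \+ L) @` XL, continuous psi}]).
Proof.
have [d d_dense] := exists_dense_seq X.
have mB := measurable_collapsing lip_ge0 phi_lip d mX.
have := ae_null_ysections mu mB
  (fun x => collapsing_section_negligible lip_ge0 phi_lip d x X_compact X_null).
apply: filterS => t muB.
pose XL : set (borel_rV R N) := X `\` ysection (collapsing X phi d) t.
have mys : measurable (ysection (collapsing X phi d) t).
  exact: measurable_ysection.
have XLX : XL `<=` X by move=> x [].
have sep x : XL x -> forall r, 0 < r -> exists2 e, 0 < e &
    forall y, X y -> r <= `|x - y| -> e <= image_dist phi t x y.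
  move=> [Xx nx]; apply: (not_collapsing_separation lip_ge0 phi_lip d_dense Xx).
  by move: nx; rewrite ysectionE.
have inj : set_inj XL (phi \+ lin_of_coords t).
  move=> x y; rewrite !inE => XLx XLy xy; apply: contrapT => /eqP nxy.
  have xy0 : 0 < `|x - y| by rewrite normr_gt0 subr_eq0.
  have [e e0 he] := sep x XLx _ xy0.
  have := he y (XLX _ XLy) (lexx _).
  by rewrite /image_dist xy subrr normr0 leNgt e0.
exists XL; split => //.
- exact: measurableD.
- apply: measure_negligible.
    by apply: measurableC; exact: measurableD.
  rewrite setCD; apply: negligibleU; apply/negligibleP => //.
  exact: measurableC.
have [psi psiK] := exists_left_inverse inj.
exists psi; first by move=> x; rewrite inE => /psiK.
apply/subspace_continuousP => _ [x XLx <-].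
apply/cvgrPdist_lt => e e0; rewrite near_withinE.
have [r r0 hr] := sep x XLx e e0.
apply/nbhs_ballP; exists r; first exact: r0.
move=> v + [y XLy fyv]; rewrite -{v}fyv -ball_normE => fxy.
rewrite -[X in X < _]/(`|psi ((phi \+ lin_of_coords t) x) -
  psi ((phi \+ lin_of_coords t) y)|).
rewrite psiK// psiK// ltNge; apply/negP => exy.
have := hr y (XLX _ XLy) exy; rewrite leNgt => /negP; apply.
exact: fxy.
Qed.

(** One exceptional set of maps must serve all exponents in [A]. Countably many rational ones
    suffice, because on a bounded set a larger Hölder exponent implies a smaller one. *)
Lemma ae_holder_inverse (A : set R) : (0 < k)%N ->
  A !=set0 -> (forall alpha, A alpha -> 0 < alpha) ->
  (forall alpha, A alpha -> exists2 q : rat, alpha <= ratr q & A (ratr q)) ->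
  (forall alpha x, A alpha -> X x -> ball_covered k alpha X x) ->
  ae_lin (fun L : {linear 'rV[R]_N -> 'rV[R]_k} =>
    exists XL : set (borel_rV R N),
      [/\ measurable XL, XL `<=` X, mu (~` XL) = 0%E,
          set_inj XL (phi \+ L) &
          exists2 psi : 'rV[R]_k -> 'rV[R]_N,
            {in XL, cancel (phi \+ L) psi} &
            forall alpha, A alpha ->
              pointwise_holder_on alpha ((phi \+ L) @` XL) psi]).
Proof.
move=> k_gt0 [a0 Aa0] A_gt0 A_rat A_ball.
have [d d_dense] := exists_dense_seq X.
pose expo (n : nat) : R := if unpickle n is Some q then ratr q else a0.
pose B n := if pselect (A (expo n)) then non_holder X phi d (expo n) else set0.
have mB n : measurable (B n).
  rewrite /B; case: pselect => [An|nAn]; last exact: measurable0.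
  exact: (measurable_non_holder lip_ge0 phi_lip d (expo n) mX).
have : {ae lebesgue_tuple R (N * k), forall t n, mu (ysection (B n) t) = 0%E}.
  apply: ae_foralln => i; apply: (ae_null_ysections mu (mB i)) => x.
  rewrite /B; case: pselect => [An|nAn].
    apply: (non_holder_section_negligible lip_ge0 phi_lip) => //.
      exact: A_gt0.
    exact: A_ball.
  by rewrite xsection0; exact: negligible_set0.
apply: filterS => t muB.
pose XL : set (borel_rV R N) := X `\` \bigcup_n ysection (B n) t.
have mU : measurable (\bigcup_n ysection (B n) t).
  by apply: bigcupT_measurable => n; exact: measurable_ysection.
have XLX : XL `<=` X by move=> x [].
have [M hM] : exists M : R, forall x, X x -> `|x| <= M.
  have [D [_ hD]] := compact_bounded X_compact; exists (`|D| + 1).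
  by apply: hD; rewrite (le_lt_trans (ler_norm _))// ltrDl.
have bound alpha x : A alpha -> XL x -> exists2 c, 0 < c &
    forall y, X y -> `|x - y| <= c * image_dist phi t x y `^ alpha.
  move=> Aal [Xx nx]; have [q alq Aq] := A_rat _ Aal.
  have nh : ~ non_holder X phi d (ratr q) (x, t).
    move=> nh; apply: nx; exists (pickle q) => //.
    by rewrite ysectionE /= /B /expo pickleK; case: pselect.
  have [c c0 hc] :=
    not_non_holder_bound lip_ge0 phi_lip d_dense (A_gt0 _ Aq) Xx nh.
  have M0 : 0 <= M by apply: le_trans (hM _ Xx).
  exists (c + (M + M)) => [|y Xy]; first by rewrite ltr_wpDr// addr_ge0.
  have F0 := image_dist_ge0 phi t x y.
  (* Up to 1 the larger exponent gives the smaller power; beyond 1 the power is at least 1 and the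
     diameter bound [M + M] is enough. *)
  have [F1|F1] := leP (image_dist phi t x y) 1.
    apply: le_trans (hc _ Xy) _; apply: ler_pM => //.
    - exact: ltW.
    - exact: powR_ge0.
    - by rewrite lerDl addr_ge0.
    have [->|Fn0] := eqVneq (image_dist phi t x y) 0.
      by rewrite !powR0// gt_eqF// A_gt0.
    by apply: ger_powR => //; rewrite lt_neqAle eq_sym Fn0 F0.
  apply: (@le_trans _ _ (M + M)).
    by apply: le_trans (ler_normB _ _) _; apply: lerD; exact: hM.
  rewrite -[leLHS]mulr1; apply: ler_pM => //; first by rewrite addr_ge0.
    by rewrite lerDr ltW.
  by rewrite -(powRr0 (image_dist phi t x y)); apply: ler_powR; rewrite ltW// A_gt0.
have inj : set_inj XL (phi \+ lin_of_coords t).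
  move=> x y; rewrite !inE => XLx XLy xy; apply: contrapT => /eqP nxy.
  have [c c0 hc] := bound a0 x Aa0 XLx.
  have := hc y (XLX _ XLy).
  rewrite /image_dist xy subrr normr0 powR0 ?gt_eqF ?A_gt0// mulr0.
  by rewrite normr_le0 subr_eq0 (negPf nxy).
exists XL; split => //.
- exact: measurableD.
- apply: measure_negligible.
    by apply: measurableC; exact: measurableD.
  rewrite setCD; apply: negligibleU.
    by apply/negligibleP => //; exact: measurableC.
  apply: negligible_bigcup => n; apply/negligibleP; last exact: muB.
  exact: measurable_ysection.
have [psi psiK] := exists_left_inverse inj.
exists psi; first by move=> x; rewrite inE => /psiK.
move=> alpha Aal _ [x XLx <-]; have [c c0 hc] := bound alpha x Aal XLx.
exists (N.+1%:R * c) => [|_ [y XLy <-]]; first by rewrite mulr_gt0.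
rewrite !psiK//; apply: le_trans (enorm_le_row_norm _) _.
rewrite -mulrA ler_wpM2l//; apply: le_trans (hc _ (XLX _ XLy)) _.
rewrite ler_wpM2l ?(ltW c0)//; apply: ge0_ler_powR.
- exact/ltW/A_gt0.
- by rewrite nnegrE image_dist_ge0.
- by rewrite nnegrE sqrtr_ge0.
- exact: row_norm_le_enorm.
Qed.

End almost_every_projection.

(** * Dimensions and covers *)

Section covers.
Context {R : realType} {N : nat}.
Implicit Types (A X : set 'rV[R]_N) (s : R) (k : nat).

Lemma finite_coverS A B M rho :
  A `<=` B -> finite_cover B M rho -> finite_cover A M rho.
Proof. by move=> AB [U [BU dU]]; exists U; split => // y /AB /BU. Qed.

Lemma covering_number_cover A delta (c : R) :
  (covering_number A delta < c%:E)%E ->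
  exists M : nat, M%:R < c /\ finite_cover A M (2 * delta).
Proof.
move=> /ereal_inf_lt[_ [M [z Az] <-]]; rewrite lte_fin => Mc.
exists M; split => //.
exists (fun n => if insub n is Some i then eball (z i) delta else set0); split.
  move=> y /Az[i _ yi]; exists (i : nat); first exact: ltn_ord.
  by rewrite valK.
move=> n y y'; case: insubP => [i _ _ | //]; rewrite /eball /= => yi yi'.
rewrite -(subrKA (z i)) mulrDl !mul1r (le_trans (ler_normD _ _))// lerD//.
  by rewrite distrC (le_trans (row_norm_le_enorm _))// ltW.
by rewrite (le_trans (row_norm_le_enorm _))// ltW.
Qed.

Lemma null_covered_finite k X : (0 < k)%N ->
  (forall eta : R, 0 < eta -> exists M rho,
    [/\ 0 <= rho, finite_cover X M rho & M%:R * rho ^+ k <= eta]) ->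
  null_covered k X.
Proof.
move=> k_gt0 h eta eta0; have [M [rho [rho0 [U [XU dU]] Mrho]]] := h _ eta0.
exists (fun i => if (i < M)%N then U i else set0).
exists (fun i => if (i < M)%N then rho else 0); split.
- by move=> y /XU[i iM Ui]; exists i; rewrite //= iM.
- by move=> i; case: ifP.
- by move=> i y y'; case: ifP => // _; exact: dU.
rewrite (nneseries_finite_support (M := M)); last 2 first.
- by move=> i; rewrite exprn_ge0//; case: ifP.
- by move=> i Mi; rewrite ltnNge Mi/= expr0n (gtn_eqF k_gt0).
rewrite lee_fin; under eq_bigr do rewrite ltn_ord.
by rewrite sumr_const card_ord -[leLHS]mulr_natl.
Qed.

(** The common form in which the box-counting and Assouad bounds enter. *)
Definition power_covered s X : Prop := exists C rho0 : R, [/\ 0 <= C, 0 < rho0 &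
  forall rho, 0 < rho < rho0 -> exists M : nat,
    finite_cover X M rho /\ M%:R <= C * rho `^ (- s)].

Lemma power_covered_null s k X : (0 < k)%N -> s < k%:R ->
  power_covered s X -> null_covered k X.
Proof.
move=> k_gt0 sk [C [rho0 [C0 rho00 h]]]; apply: null_covered_finite => // eta eta0.
have ks0 : 0 < k%:R - s by rewrite subr_gt0.
pose e := eta / (C + 1).
have e0 : 0 < e by rewrite divr_gt0// ltr_wpDl.
(* The second bound gives [rho]^ (k%:R - s) <= e[, and the total]M%:R * rho ^+ k[is at most]C * rho
   [^ (k%:R - s)]. *)
pose rho := Num.min (rho0 / 2) (e `^ (k%:R - s)^-1).
have rho_gt0 : 0 < rho by rewrite lt_min divr_gt0//= powR_gt0.
have [|M [MX MC]] := h rho.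
  by rewrite rho_gt0/= gt_min ltr_pdivrMr// mulr_natr mulr2n ltrDl rho00.
exists M, rho; split => //; first exact: ltW.
apply: (@le_trans _ _ (C * rho `^ (- s) * rho ^+ k)).
  by rewrite ler_wpM2r// exprn_ge0// ltW.
rewrite -powR_mulrn ?(ltW rho_gt0)// -mulrA -powRD; last first.
  by rewrite (gt_eqF rho_gt0) implybT.
rewrite addrC.
apply: (@le_trans _ _ (C * e)).
  rewrite ler_wpM2l//.
  have -> : e = (e `^ (k%:R - s)^-1) `^ (k%:R - s).
    by rewrite -powRrM mulVf ?gt_eqF// powRr1// ltW.
  apply: ge0_ler_powR; rewrite ?nnegrE ?powR_ge0 ?(ltW ks0) ?(ltW rho_gt0)//.
  by rewrite ge_min lexx orbT.
by rewrite /e mulrCA ger_pMr// ler_pdivrMr ?ltr_wpDl// mul1r lerDl.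
Qed.

Lemma powR_dyadic (n : nat) (a : R) : (2 ^- n) `^ a = 2 `^ (- (n%:R * a)).
Proof.
by rewrite -powR_invn// -powRrM mulNr.
Qed.

Lemma ball_covered_rate k (alpha a C : R) X x (n0 : nat) :
  0 <= C -> a + k%:R * (1 - alpha^-1) < 0 ->
  (forall n, (n0 <= n)%N -> exists M : nat,
    finite_cover [set y | X y /\ `|x - y| < 2 ^- n] M ((2 ^- n) `^ alpha^-1) /\
    M%:R <= C * 2 `^ (n%:R * a)) ->
  ball_covered k alpha X x.
Proof.
move=> C0 e0 h; exists C, (2 `^ (a + k%:R * (1 - alpha^-1))), n0; split => //.
  rewrite powR_gt0//= -[a + _]opprK powRN invf_lt1 ?powR_gt0//.
  rewrite -[ltLHS](congr1 (@^~ (- (a + k%:R * (1 - alpha^-1)))) (powR1 R)).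
  by apply: gt0_ltr_powR; rewrite ?oppr_gt0// ?nnegrE// ltr1n.
move=> n /h[M [MX MC]]; exists M; split => //.
apply: (@le_trans _ _ (C * 2 `^ (n%:R * a) * (2 ^+ n * (2 ^- n) `^ alpha^-1) ^+ k)).
  by rewrite ler_wpM2r// exprn_ge0// mulr_ge0// powR_ge0.
rewrite -mulrA ler_wpM2l// powR_dyadic.
have -> : 2 ^+ n = 2 `^ n%:R :> R by rewrite powR_mulrn.
rewrite -powRD ?pnatr_eq0 ?implybT//.
rewrite -!powR_mulrn ?powR_ge0// -!powRrM -powRD ?pnatr_eq0 ?implybT//.
rewrite le_eqVlt; apply/orP; left; apply/eqP; congr powR; ring.
Qed.

(** A cover of all of [X] at scale [2 ^- n] to the power [alpha^-1] has growth rate [a = s / alpha],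
    and the rate condition becomes [s < k%:R - alpha * k%:R]. *)
Lemma power_covered_ball s k (alpha : R) X x : 0 < alpha ->
  s < k%:R - alpha * k%:R -> power_covered s X -> ball_covered k alpha X x.
Proof.
move=> al0 sk [C [rho0 [C0 rho00 h]]].
have [n0 hn0] : exists n0 : nat, forall n, (n0 <= n)%N ->
    (2 ^- n) `^ alpha^-1 < rho0.
  have [m hm] := @exists_invr_nat_le _ (rho0 `^ alpha) (powR_gt0 _ rho00).
  exists m.+1 => n mn.
  have -> : rho0 = (rho0 `^ alpha) `^ alpha^-1.
    by rewrite -powRrM divff ?gt_eqF// powRr1// ltW.
  apply: gt0_ltr_powR; rewrite ?invr_gt0 ?nnegrE ?powR_ge0//.
  apply: lt_le_trans hm; rewrite ltf_pV2 ?posrE ?exprn_gt0//.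
  by rewrite -natrX ltr_nat (leq_ltn_trans mn)// ltn_expl.
apply: (@ball_covered_rate _ _ (s / alpha) C _ _ n0) => //.
  rewrite (_ : _ + _ = (s - (k%:R - alpha * k%:R)) / alpha); last first.
    by field; rewrite gt_eqF.
  by rewrite pmulr_llt0 ?invr_gt0// subr_lt0.
move=> n /hn0 hn; have [|M [MX MC]] := h ((2 ^- n) `^ alpha^-1).
  by rewrite hn andbT powR_gt0// invr_gt0 exprn_gt0.
exists M; split; first by apply: finite_coverS MX => y [].
apply: le_trans MC _; rewrite powR_dyadic -powRrM.
rewrite (_ : - (n%:R * alpha^-1) * - s = n%:R * (s / alpha))//.
by rewrite mulrNN -mulrA [alpha^-1 * s]mulrC.
Qed.

End covers.

(** * Covers from the Hausdorff, box-counting and Assouad dimensions *)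

Section dimensions.
Context {R : realType} {N : nat}.
Implicit Types (X : set 'rV[R]_N) (s : R) (k : nat).

Lemma ereal_lt_between (d : \bar R) (r : R) : (d < r%:E)%E ->
  exists2 s : R, (d < s%:E)%E & s < r.
Proof.
case: d => [d||] //; last by move=> _; exists (r - 1); [exact: ltNyr|lra].
by rewrite lte_fin => dr; exists ((d + r) / 2); [rewrite lte_fin|]; lra.
Qed.

Lemma hausdorff_dim_null k X : (hausdorff_dim X < k%:R%:E)%E -> null_covered k X.
Proof.
move=> /ereal_inf_lt[_ [s [s0 Hs0] <-]]; rewrite lte_fin => sk eta eta0.
(* Scale 1 is chosen so that diameters are at most 1 and their [k]-th powers are below their [s]-th
   powers. *)
have : (hausdorff_premeasure s 1 X < eta%:E)%E.
  apply: le_lt_trans (_ : (_ <= 0)%E) _; last by rewrite lte_fin.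
  by rewrite -Hs0; apply: ereal_sup_ubound; exists 1 => //=; exact: ltr01.
move=> /ereal_inf_lt[_ [U [XU U1] <-]] sumU.
have diam_ge0 i : (0 <= ediam (U i))%E by apply: ereal_sup_ubound; left.
have diam_fin i : ediam (U i) \is a fin_num.
  by rewrite ge0_fin_numE// (le_lt_trans (U1 i))// ltry.
exists U, (fun i => fine (ediam (U i))); split => //.
- by move=> i; exact: fine_ge0.
- move=> i y y' Uy Uy'; rewrite -lee_fin fineK//.
  apply: (@le_trans _ _ (enorm (y - y'))%:E).
    by rewrite lee_fin row_norm_le_enorm.
  by apply: ereal_sup_ubound; right; exists (y, y').
apply: le_trans (ltW sumU); apply: lee_nneseries => i _.
  by rewrite lee_fin exprn_ge0// fine_ge0.
rewrite -[X in poweR X s]fineK// poweR_EFin lee_fin.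
have : 0 <= fine (ediam (U i)) <= 1.
  by rewrite fine_ge0//= -lee_fin fineK.
move: (fine _) => a /andP[a0 a1]; rewrite -powR_mulrn//.
have [->|an0] := eqVneq a 0.
  by rewrite !powR0// gt_eqF// (lt_trans s0).
by apply: ger_powR; [rewrite lt_def an0 a0 a1|exact: ltW].
Qed.

Lemma upper_box_dim_power s X : (upper_box_dim X < s%:E)%E -> power_covered s X.
Proof.
move=> /ereal_inf_lt[_ [V V0 <-]] supV.
have /nbhs_ballP[e /= e0 eV] : nbhs (0 : R) [set x | 0 < x -> V x] by exact: V0.
have cover delta : 0 < delta < Num.min e 1 ->
    (covering_number X delta < (delta `^ (- s))%:E)%E.
  rewrite lt_min => /and3P[d0 de d1].
  have q0 : 0 < - ln delta by rewrite oppr_gt0 ln_lt0// d0.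
  have : (lne (covering_number X delta) * ((- ln delta)^-1)%:E < s%:E)%E.
    apply: le_lt_trans supV; apply: ereal_sup_ubound; exists delta => //.
    by apply: eV => //; rewrite -ball_normE /= sub0r normrN gtr0_norm.
  (* An infinite covering number would make the quotient [+oo], against the bound by [s]. *)
  case: (covering_number X delta) => [r||_]; last 2 first.
  - by rewrite /= gt0_mulye// lte_fin invr_gt0.
  - exact: ltNyr.
  rewrite lte_fin; have [r0 _|r0] := leP r 0.
    exact: le_lt_trans r0 (powR_gt0 _ d0).
  rewrite lne_EFin// -EFinM lte_fin ltr_pdivrMr// => rs.
  rewrite -[ltLHS]lnK ?posrE// /powR gt_eqF// ltr_expR.
  by rewrite mulNr -mulrN.
exists (2 `^ s), (2 * Num.min e 1); split.
- exact: powR_ge0.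
- by rewrite mulr_gt0// lt_min e0 ltr01.
move=> rho /andP[rho0 rhoe].
have [|M [MC MX]] := @covering_number_cover _ _ X (rho / 2) _ (cover (rho / 2) _).
  by rewrite divr_gt0//= ltr_pdivrMr// mulrC.
exists M; split; first by move: MX; rewrite mulrC divfK.
apply: le_trans (ltW MC) _.
rewrite powRM ?invr_ge0 ?(ltW rho0)// -[2^-1]powR_inv1// -powRrM mulN1r opprK.
by rewrite mulrC.
Qed.

Lemma homogeneous_cover M s X x (r rho : R) : 0 < M -> homogeneous M s X ->
  X x -> 0 < rho < 2 * r ->
  exists n : nat, finite_cover (X `&` eball x r) n rho /\
    n%:R <= 2 * M * (2 * r) `^ s * rho `^ (- s).
Proof.
move=> M0 hX Xx /andP[rho0 rhor].
have rho20 : 0 < rho / 2 by rewrite divr_gt0.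
have r0 : 0 < 2 * r by exact: lt_trans rhor.
have bE : M * (r / (rho / 2)) `^ s = M * (2 * r) `^ s * rho `^ (- s).
  rewrite (_ : r / (rho / 2) = 2 * r * rho^-1); last by field; rewrite gt_eqF.
  by rewrite powRM ?invr_ge0 ?ltW// -powR_inv1 ?ltW// -powRrM mulN1r mulrA.
(* Radius [rho / 2] yields pieces of diameter [rho]; the extra factor 2 makes the bound on the
   infimum strict. *)
have [|n [nM nX]] := @covering_number_cover _ _ (X `&` eball x r) (rho / 2)
    (2 * (M * (r / (rho / 2)) `^ s)).
  apply: le_lt_trans (hX x r (rho / 2) Xx rho20 _) _.
    by rewrite ltr_pdivrMr// mulrC.
  rewrite lte_fin ltr_pMl ?ltr1n// mulr_gt0// powR_gt0// divr_gt0//.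
  by move: r0; rewrite pmulr_rgt0.
exists n; split; first by move: nX; rewrite mulrC divfK.
by rewrite (le_trans (ltW nM))// bE !mulrA.
Qed.

(** A nonempty bounded [X] lies in a single ball around any of its points, where homogeneity
    applies. *)
Lemma homogeneous_power M s X : compact X -> 0 < M -> homogeneous M s X ->
  power_covered s X.
Proof.
move=> cX M0 hX; have [X0|/set0P[x Xx]] := eqVneq X set0.
  exists 0, 1; split => // rho _; exists 0%N; split; last by rewrite mul0r.
  by exists (fun=> set0); split => // y; rewrite X0.
have [D [_ hD]] := compact_bounded cX.
have XB y : X y -> `|y| <= `|D| + 1.
  by apply: hD; rewrite (le_lt_trans (ler_norm _))// ltrDl.
pose B := `|D| + 1 + (`|D| + 1).
have B0 : 0 <= B by rewrite !addr_ge0.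
pose r := N.+1%:R * B + 1.
have r0 : 0 < r by rewrite ltr_wpDl// mulr_ge0.
exists (2 * M * (2 * r) `^ s), (2 * r); split.
- by rewrite mulr_ge0 ?powR_ge0// mulr_ge0// ltW.
- by rewrite mulr_gt0.
move=> rho /(homogeneous_cover M0 hX Xx)[n [nX nM]]; exists n; split => //.
apply: finite_coverS nX => y Xy; split => //; rewrite /eball /=.
apply: le_lt_trans (enorm_le_row_norm _) _.
rewrite /r (@le_lt_trans _ _ (N.+1%:R * B)) ?ltrDl// ler_wpM2l//.
by rewrite (le_trans (ler_normB _ _))// lerD// XB.
Qed.

(** Only the ratio of the two scales counts, so the rate is [a = (alpha^-1 - 1) * s], and the rate
    condition reduces to [s < k%:R] for every [alpha] below 1. *)
Lemma homogeneous_ball M s k (alpha : R) X x : 0 < M -> homogeneous M s X ->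
  X x -> s < k%:R -> 0 < alpha < 1 -> ball_covered k alpha X x.
Proof.
move=> M0 hX Xx sk /andP[al0 al1].
have ial : 1 < alpha^-1 by rewrite invf_gt1.
apply: (@ball_covered_rate _ _ _ _ ((alpha^-1 - 1) * s)
  (2 * M * (2 * N.+1%:R) `^ s) _ _ 0).
- by rewrite mulr_ge0 ?powR_ge0// mulr_ge0// ltW.
- rewrite (_ : _ + _ = (s - k%:R) * (alpha^-1 - 1)); last by ring.
  by rewrite pmulr_llt0 ?subr_lt0// subr_gt0.
move=> n _; pose rho : R := (2 ^- n) `^ alpha^-1.
have p0 : 0 < 2 ^- n :> R by rewrite invr_gt0 exprn_gt0.
have p1 : 2 ^- n <= 1 :> R by rewrite invf_le1 ?exprn_gt0// exprn_ege1// ler1n.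
have rho0 : 0 < rho by exact: powR_gt0.
have rho1 : rho <= 2 ^- n by apply: ge1r_powR; rewrite ?p0// ltW.
(* The factor [N.+1%:R] makes the Euclidean ball contain the maximum-norm ball of radius
   [2 ^- n]. *)
have [|m [mX mM]] := @homogeneous_cover M s X x (N.+1%:R * 2 ^- n) rho M0 hX Xx.
  rewrite rho0/= (le_lt_trans rho1)// mulrA ltr_pMl//.
  by rewrite -natrM ltr1n mulnS.
exists m; split.
  apply: finite_coverS mX => y [Xy xy]; split => //; rewrite /eball /=.
  by apply: le_lt_trans (enorm_le_row_norm _) _; rewrite ltr_pM2l.
apply: le_trans mM _; rewrite mulrA powRM ?(ltW p0)//.
rewrite -!mulrA !ler_wpM2l ?powR_ge0 ?(ltW M0)//.
rewrite /rho !powR_dyadic -powRrM -powRD ?pnatr_eq0 ?implybT//.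
by rewrite le_eqVlt; apply/orP; left; apply/eqP; congr powR; ring.
Qed.

End dimensions.

(** * Deduction of the three statements *)

Lemma ae_lin_impl (R : realType) (N k : nat)
    (P Q : {linear 'rV[R]_N -> 'rV[R]_k} -> Prop) :
  (forall L, P L -> Q L) -> ae_lin P -> ae_lin Q.
Proof. by move=> PQ; apply: negligibleS => t /= nQ /PQ. Qed.

Lemma elipschitz_row_norm (R : realType) (N k : nat) (X : set 'rV[R]_N)
    (phi : 'rV[R]_N -> 'rV[R]_k) : elipschitz_on X phi ->
  exists2 c : R, 0 <= c &
    forall x y, X x -> X y -> `|phi x - phi y| <= c * `|x - y|.
Proof.
move=> [C hC]; exists (`|C| * N.+1%:R) => [|x y Xx Xy]; first by rewrite mulr_ge0.
apply: le_trans (row_norm_le_enorm _) (le_trans (hC _ _ Xx Xy) _).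
apply: (@le_trans _ _ (`|C| * enorm (x - y))).
  by rewrite ler_wpM2r ?sqrtr_ge0// ler_norm.
by rewrite -mulrA ler_wpM2l// enorm_le_row_norm.
Qed.

Lemma holder_exponentE (R : realType) (d : \bar R) (k : nat) (alpha : R) :
  (0 < k)%N -> (d < k%:R%:E)%E -> (alpha%:E < 1 - d * (k%:R^-1)%:E)%E ->
  (d < (k%:R - alpha * k%:R)%:E)%E.
Proof.
move=> k_gt0; have k0 : 0 < k%:R :> R by rewrite ltr0n.
case: d => [d _|//|_ _]; last exact: ltNyr.
rewrite -EFinM -EFinB !lte_fin => al.
have -> : d = k%:R - (1 - d * k%:R^-1) * k%:R by field; rewrite gt_eqF.
by rewrite ltrD2l ltrN2 ltr_pM2r.
Qed.

Theorem theorem1p12 (R : realType) (N k : nat)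
    (N_gt0 : (0 < N)%N) (k_gt0 : (0 < k)%N)
    (mu : {finite_measure set (borel_rV R N) -> \bar R})
    (X : set 'rV[R]_N) (X_supp : X = measure_support mu)
    (X_compact : compact X)
    (phi : 'rV[R]_N -> 'rV[R]_k) (phi_lip : elipschitz_on X phi) :
  [/\ (hausdorff_dim X < (k%:R)%:E)%E ->
      ae_lin (fun L : {linear 'rV[R]_N -> 'rV[R]_k} =>
        exists XL : set (borel_rV R N),
          [/\ measurable XL, XL `<=` X, mu (~` XL) = 0%E,
              set_inj XL (phi \+ L) &
              exists2 psi : 'rV[R]_k -> 'rV[R]_N,
                {in XL, cancel (phi \+ L) psi} &
                {within (phi \+ L) @` XL, continuous psi}]),
      (upper_box_dim X < (k%:R)%:E)%E ->
      ae_lin (fun L : {linear 'rV[R]_N -> 'rV[R]_k} =>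
        exists XL : set (borel_rV R N),
          [/\ measurable XL, XL `<=` X, mu (~` XL) = 0%E,
              set_inj XL (phi \+ L) &
              exists2 psi : 'rV[R]_k -> 'rV[R]_N,
                {in XL, cancel (phi \+ L) psi} &
                forall alpha : R, 0 < alpha ->
                  (alpha%:E < 1 - upper_box_dim X * (k%:R^-1)%:E)%E ->
                  pointwise_holder_on alpha ((phi \+ L) @` XL) psi]) &
      (assouad_dim X < (k%:R)%:E)%E ->
      ae_lin (fun L : {linear 'rV[R]_N -> 'rV[R]_k} =>
        exists XL : set (borel_rV R N),
          [/\ measurable XL, XL `<=` X, mu (~` XL) = 0%E,
              set_inj XL (phi \+ L) &
              exists2 psi : 'rV[R]_k -> 'rV[R]_N,
                {in XL, cancel (phi \+ L) psi} &
                forall alpha : R, 0 < alpha -> alpha < 1 ->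
                  pointwise_holder_on alpha ((phi \+ L) @` XL) psi])].
Proof.
have [lip lip_ge0 phi_lipn] := elipschitz_row_norm phi_lip.
have X_full : mu (~` X) = 0%E by rewrite X_supp measure_support_full.
have k0 : 0 < k%:R :> R by rewrite ltr0n.
split=> dimX.
- apply: (ae_continuous_inverse lip_ge0 phi_lipn) => //.
  exact: hausdorff_dim_null.
- have [s ds sk] := ereal_lt_between dimX.
  have Xk : null_covered k X.
    exact: power_covered_null k_gt0 sk (upper_box_dim_power ds).
  pose A : set R := [set alpha | 0 < alpha /\
    (upper_box_dim X < (k%:R - alpha * k%:R)%:E)%E].
  have : ae_lin (fun L : {linear 'rV[R]_N -> 'rV[R]_k} =>
    exists XL : set (borel_rV R N),
      [/\ measurable XL, XL `<=` X, mu (~` XL) = 0%E,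
          set_inj XL (phi \+ L) &
          exists2 psi : 'rV[R]_k -> 'rV[R]_N,
            {in XL, cancel (phi \+ L) psi} &
            forall alpha, A alpha ->
              pointwise_holder_on alpha ((phi \+ L) @` XL) psi]).
    apply: (ae_holder_inverse lip_ge0 phi_lipn) => //.
    (* For this exponent [k%:R - alpha * k%:R] equals [s]. *)
    + exists ((k%:R - s) / k%:R); split.
        by rewrite divr_gt0// subr_gt0.
      by rewrite divfK ?gt_eqF// opprB addrCA subrr addr0.
    + by move=> alpha [].
    (* A real [r] strictly in between leaves room for a rational exponent above [alpha] that still
       lies in [A]. *)
    + move=> alpha [al0 /ereal_lt_between[r dr ral]].
      have : alpha < (k%:R - r) / k%:R by rewrite ltr_pdivlMr//; lra.
      move=> /rat_in_itvoo[q]; rewrite in_itv/= => /andP[alq qr].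
      exists q; first exact: ltW.
      split; first exact: lt_trans alq.
      apply: lt_trans dr _; rewrite lte_fin.
      by move: qr; rewrite ltr_pdivlMr// ltrBrDr -ltrBrDl.
    + move=> alpha x [al0 /ereal_lt_between[r dr ral]] _.
      exact: power_covered_ball al0 ral (upper_box_dim_power dr).
  apply: ae_lin_impl => L [XL [mXL XLX muXL injXL [psi psiK hold]]].
  exists XL; split => //; exists psi => // alpha al0 al1.
  by apply: hold; split => //; exact: holder_exponentE.
- move: dimX => /ereal_inf_lt[_ [s [s0 [M M0 hM]] <-]]; rewrite lte_fin => sk.
  have Xk : null_covered k X.
    exact: power_covered_null k_gt0 sk (homogeneous_power X_compact M0 hM).
  have : ae_lin (fun L : {linear 'rV[R]_N -> 'rV[R]_k} =>
    exists XL : set (borel_rV R N),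
      [/\ measurable XL, XL `<=` X, mu (~` XL) = 0%E,
          set_inj XL (phi \+ L) &
          exists2 psi : 'rV[R]_k -> 'rV[R]_N,
            {in XL, cancel (phi \+ L) psi} &
            forall alpha, [set a : R | 0 < a < 1] alpha ->
              pointwise_holder_on alpha ((phi \+ L) @` XL) psi]).
    apply: (ae_holder_inverse lip_ge0 phi_lipn) => //.
    + by exists 2^-1; rewrite /= invr_gt0 ltr0n/= invf_lt1// ltr1n.
    + by move=> alpha /andP[].
    + move=> alpha /andP[al0 /rat_in_itvoo[q]]; rewrite in_itv/= => /andP[alq q1].
      by exists q; [exact: ltW|rewrite /= q1 (lt_trans al0)].
    + by move=> alpha x al Xx; exact: homogeneous_ball M0 hM Xx sk al.
  apply: ae_lin_impl => L [XL [mXL XLX muXL injXL [psi psiK hold]]].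
  exists XL; split => //; exists psi => // alpha al0 al1.
  by apply: hold; rewrite /= al0.
Qed.
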